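(* Let $\varphi\colon\mathcal{H}_0\to\mathbb{C}$ be a linear functional. The following are equivalent: (i) the Verma module $M(\varphi)$ is irreducible; (ii) the Shapovalov form $\mathcal{S}_\varphi$ is non-degenerate on $M(\varphi)$; (iii) $\varphi$ is Shapovalov-regular, i.e. $\det(G_n)\neq0$ for every $n\ge1$; (iv) $\varphi(c)\ne0$. Moreover, for every $\varphi$ and every $n$, the Gram matrix $G_n$ of $\mathcal{S}_\varphi$ on $M(\varphi)[-n]$ is diagonal in the Poincaré–Birkhoff–Witt basis $\{b_{-\lambda}v_\varphi:\lambda\vdash n\}$, with $$\det(G_n)=\prod_{\lambda\vdash n}\ \prod_{k\ge1}\bigl(k\,\omega_1\,\varphi(c)\bigr)^{m_k(\lambda)}\,m_k(\lambda)!\,,$$ where $m_k(\lambda)$ is the multiplicity of $k$ in the partition $\lambda$.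
   Context: $\mathcal{H}=\mathcal{H}_2$ denotes the complex Lie algebra with basis $\{b_k:k\in\mathbb{Z}\}\cup\{c\}$, with $c$ central and $[b_k,b_l]=k\,\delta_{k+l,0}\,\omega_1\,c$, where $\omega_1>0$ is a fixed real constant. (It is the Heisenberg subalgebra attached to the genus-zero curve $u^2=1-2at+t^2$, the case $m=2$, $r=1$; only these brackets are used.) Put $\mathcal{H}_+=\bigoplus_{k>0}\mathbb{C}b_k$, $\mathcal{H}_0=\mathbb{C}b_0\oplus\mathbb{C}c$, $\mathcal{H}_-=\bigoplus_{k<0}\mathbb{C}b_k$. For a linear functional $\varphi\colon\mathcal{H}_0\to\mathbb{C}$, the Verma module is $M(\varphi)=U(\mathcal{H})\otimes_{U(\mathcal{H}_+\oplus\mathcal{H}_0)}\mathbb{C}_\varphi$, where $\mathbb{C}_\varphi$ is one-dimensional, $b_k$ ($k>0$) acts by $0$, and $b_0$, $c$ act by $\varphi(b_0)$, $\varphi(c)$; $v_\varphi$ is the image of $1$. For a partition $\lambda=(\lambda_1\ge\dots\ge\lambda_s>0)$ write $b_{-\lambda}v_\varphi:=b_{-\lambda_1}\cdots b_{-\lambda_s}v_\varphi$. These vectors form a basis of $M(\varphi)$; $M(\varphi)[-n]$ is the span of those with $\lambda\vdash n$. Let $\omega$ be the anti-automorphism of $U(\mathcal{H})$ with $\omega(b_k)=b_{-k}$, $\omega(c)=c$. The Shapovalov form $\mathcal{S}_\varphi$ is the unique symmetric bilinear form on $M(\varphi)$ with $\mathcal{S}_\varphi(v_\varphi,v_\varphi)=1$,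 $\mathcal{S}_\varphi(xv,w)=\mathcal{S}_\varphi(v,\omega(x)w)$ for $x\in U(\mathcal{H})$, and $\mathcal{S}_\varphi(M(\varphi)[-n],M(\varphi)[-n'])=0$ for $n\ne n'$. Let $G_n$ be its Gram matrix on $M(\varphi)[-n]$, with entries $\mathcal{S}_\varphi(b_{-\lambda}v_\varphi,b_{-\mu}v_\varphi)$, $\lambda,\mu\vdash n$. *)

(* Defs.v *)
From HB Require Import structures.
From mathcomp Require Import all_boot all_order all_algebra.
From mathcomp Require Import generic_quotient finmap monalg.
From mathcomp Require Import boolp classical_sets reals.
From mathcomp Require Import complex.

Set Implicit Arguments.
Unset Strict Implicit.
Unset Printing Implicit Defensive.

Import Order.TTheory GRing.Theory Num.Theory.

Local Open Scope ring_scope.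
Local Open Scope quotient_scope.

HB.mixin Record Lmodule_isLie (K : fieldType) L of GRing.Lmodule K L := {
  lie : L -> L -> L;
  lie_linearl : forall z a x y, lie (a *: x + y) z = a *: lie x z + lie y z;
  lie_linearr : forall z a x y, lie z (a *: x + y) = a *: lie z x + lie z y;
  liexx : forall x, lie x x = 0;
  lie_jacobi : forall x y z,
    lie x (lie y z) + lie y (lie z x) + lie z (lie x y) = 0
}.

#[short(type="lieAlgType")]
HB.structure Definition LieAlgebra (K : fieldType) :=
  {L of Lmodule_isLie K L & GRing.Lmodule K L}.

(* Universal enveloping algebra: the associative unital K-algebra generated   *)
(* by L, subject to linearity of the inclusion and to xy - yx = [x, y]. It is *)
(* the quotient of formal expressions by the least congruence containing      *)
(* these relations and the axioms of K-algebras.                              *)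

Inductive uterm (K L : Type) : Type :=
  | UGen of L
  | UScal of K
  | UAdd of uterm K L & uterm K L
  | UMul of uterm K L & uterm K L.
Arguments UGen {K L}.
Arguments UScal {K L}.

HB.instance Definition _ K L := gen_eqMixin (uterm K L).
HB.instance Definition _ K L := gen_choiceMixin (uterm K L).

Section Uea.
Context {K : fieldType} (L : lieAlgType K).
Notation T := (uterm K L).

Inductive ucong : T -> T -> Prop :=
  | UC_refl s : ucong s s
  | UC_sym s t : ucong s t -> ucong t s
  | UC_trans s t u : ucong s t -> ucong t u -> ucong s u
  | UC_add s s' t t' : ucong s s' -> ucong t t' ->
      ucong (UAdd s t) (UAdd s' t')
  | UC_mul s s' t t' : ucong s s' -> ucong t t' ->
      ucong (UMul s t) (UMul s' t')
  | UC_addA s t u : ucong (UAdd s (UAdd t u)) (UAdd (UAdd s t) u)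
  | UC_addC s t : ucong (UAdd s t) (UAdd t s)
  | UC_add0 s : ucong (UAdd (UScal 0) s) s
  | UC_mulA s t u : ucong (UMul s (UMul t u)) (UMul (UMul s t) u)
  | UC_mul1l s : ucong (UMul (UScal 1) s) s
  | UC_mul1r s : ucong (UMul s (UScal 1)) s
  | UC_mul0l s : ucong (UMul (UScal 0) s) (UScal 0)
  | UC_mulDl s t u : ucong (UMul (UAdd s t) u) (UAdd (UMul s u) (UMul t u))
  | UC_mulDr s t u : ucong (UMul s (UAdd t u)) (UAdd (UMul s t) (UMul s u))
  | UC_scalD a b : ucong (UScal (a + b)) (UAdd (UScal a) (UScal b))
  | UC_scalM a b : ucong (UScal (a * b)) (UMul (UScal a) (UScal b))
  | UC_scalC a s : ucong (UMul (UScal a) s) (UMul s (UScal a))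
  | UC_genL a x y :
      ucong (UGen (a *: x + y)) (UAdd (UMul (UScal a) (UGen x)) (UGen y))
  | UC_genB x y :
      ucong (UAdd (UGen (lie x y)) (UMul (UGen y) (UGen x)))
            (UMul (UGen x) (UGen y)).

Definition ucongb : rel T := fun s t => `[< ucong s t >].

Fact ucongb_equiv : equiv_class_of ucongb.
Proof.
split=> [s|s t|t s u].
- by apply/asboolP; exact: UC_refl.
- by apply/asboolP/asboolP => h; exact: UC_sym.
- by move=> /asboolP h1 /asboolP h2; apply/asboolP; exact: UC_trans h1 h2.
Qed.

Canonical ucong_equiv := EquivRelPack ucongb_equiv.

Definition uea := {eq_quot ucong_equiv}.

HB.instance Definition _ := Choice.on uea.

Definition upi (t : T) : uea := \pi_({eq_quot ucong_equiv}) t.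

Lemma upiP s t : upi s = upi t <-> ucong s t.
Proof. by split=> [/eqquotP/asboolP|h] //; apply/eqquotP/asboolP. Qed.

Definition urepr (u : uea) : T := repr (u : {eq_quot ucong_equiv}).

Lemma ureprK u : upi (urepr u) = u.
Proof. exact: reprK. Qed.

Lemma upi_repr t : ucong (urepr (upi t)) t.
Proof. by apply/upiP; rewrite ureprK. Qed.

Definition uadd u v := upi (UAdd (urepr u) (urepr v)).
Definition umul u v := upi (UMul (urepr u) (urepr v)).
Definition uscale a u := umul (upi (UScal a)) u.

Lemma upiD s t : upi (UAdd s t) = uadd (upi s) (upi t).
Proof. by apply/upiP/UC_sym/UC_add; exact: upi_repr. Qed.

Lemma upiM s t : upi (UMul s t) = umul (upi s) (upi t).
Proof. by apply/upiP/UC_sym/UC_mul; exact: upi_repr. Qed.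

Lemma uW (P : uea -> Prop) : (forall t, P (upi t)) -> forall u, P u.
Proof. by move=> h u; rewrite -[u]ureprK. Qed.

Fact uaddA : associative uadd.
Proof.
elim/uW => s; elim/uW => t; elim/uW => u.
by rewrite -!upiD; apply/upiP/UC_addA.
Qed.

Fact uaddC : commutative uadd.
Proof. by elim/uW => s; elim/uW => t; rewrite -!upiD; apply/upiP/UC_addC. Qed.

Fact uadd0 : left_id (upi (UScal 0)) uadd.
Proof. by elim/uW => s; rewrite -!upiD; apply/upiP/UC_add0. Qed.

Fact umulA : associative umul.
Proof.
elim/uW => s; elim/uW => t; elim/uW => u.
by rewrite -!upiM; apply/upiP/UC_mulA.
Qed.

Fact umul1l : left_id (upi (UScal 1)) umul.
Proof. by elim/uW => s; rewrite -!upiM; apply/upiP/UC_mul1l. Qed.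

Fact umul1r : right_id (upi (UScal 1)) umul.
Proof. by elim/uW => s; rewrite -!upiM; apply/upiP/UC_mul1r. Qed.

Fact umulDl : left_distributive umul uadd.
Proof.
elim/uW => s; elim/uW => t; elim/uW => u.
by rewrite -!(upiM, upiD); apply/upiP/UC_mulDl.
Qed.

Fact umulDr : right_distributive umul uadd.
Proof.
elim/uW => s; elim/uW => t; elim/uW => u.
by rewrite -!(upiM, upiD); apply/upiP/UC_mulDr.
Qed.

Fact uscalD a b : upi (UScal (a + b)) = uadd (upi (UScal a)) (upi (UScal b)).
Proof. by rewrite -upiD; apply/upiP/UC_scalD. Qed.

Fact uaddN : left_inverse (upi (UScal 0)) (uscale (-1)) uadd.
Proof.
move=> u; rewrite /uscale -{2}[u]umul1l -umulDl -uscalD addNr.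
by elim/uW: u => s; rewrite -upiM; apply/upiP/UC_mul0l.
Qed.

HB.instance Definition _ :=
  GRing.isZmodule.Build uea uaddA uaddC uadd0 uaddN.

(* The augmentation U(L) -> K shows that U(L) is not the zero ring. *)
Fixpoint uaug (t : T) : K :=
  match t with
  | UGen _ => 0
  | UScal a => a
  | UAdd s t => uaug s + uaug t
  | UMul s t => uaug s * uaug t
  end.

Lemma uaug_cong s t : ucong s t -> uaug s = uaug t.
Proof.
elim=> //= *; rewrite ?(addr0, add0r, mul0r, mulr0, mul1r, mulr1) //.
all: try congruence.
- by rewrite addrA.
- by rewrite addrC.
- by rewrite mulrA.
- by rewrite mulrDl.
- by rewrite mulrDr.
- by rewrite mulrC.
Qed.

Fact uone_neq0 : upi (UScal 1) != 0 :> uea.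
Proof. by apply/eqP => /upiP/uaug_cong/= /eqP; rewrite oner_eq0. Qed.

HB.instance Definition _ := GRing.Zmodule_isNzRing.Build uea
  umulA umul1l umul1r umulDl umulDr uone_neq0.

Fact uscaleA a b u : uscale a (uscale b u) = uscale (a * b) u.
Proof.
rewrite /uscale umulA; congr umul.
by rewrite -upiM; apply/esym/upiP/UC_scalM.
Qed.

Fact uscale1 : left_id 1 uscale.
Proof. exact: umul1l. Qed.

Fact uscaleDr : right_distributive uscale +%R.
Proof. by move=> a u v; exact: umulDr. Qed.

Fact uscaleDl u : {morph uscale^~ u : a b / a + b}.
Proof. by move=> a b; rewrite /uscale uscalD; exact: umulDl. Qed.

HB.instance Definition _ := GRing.Zmodule_isLmodule.Build K uea
  uscaleA uscale1 uscaleDr uscaleDl.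

Fact uscaleAl a (u v : uea) : a *: (u * v) = a *: u * v.
Proof. exact: umulA. Qed.

HB.instance Definition _ := GRing.Lmodule_isLalgebra.Build K uea uscaleAl.

Fact uscaleAr a (u v : uea) : a *: (u * v) = u * (a *: v).
Proof.
rewrite uscaleAl [RHS]umulA; congr (_ * _).
by elim/uW: u => s; rewrite -[RHS]upiM -[LHS]upiM; apply/upiP/UC_scalC.
Qed.

HB.instance Definition _ := GRing.Lalgebra_isAlgebra.Build K uea uscaleAr.

Definition uea_gen (x : L) : uea := upi (UGen x).

Fact uea_gen_linear : linear uea_gen.
Proof.
move=> a x y.
have -> : a *: uea_gen x = upi (UMul (UScal a) (UGen x)) by rewrite upiM.
by rewrite -[RHS]upiD; apply/upiP/UC_genL.
Qed.

HB.instance Definition _ :=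
  GRing.isLinear.Build K L uea _ uea_gen uea_gen_linear.

Lemma uea_genB x y :
  uea_gen (lie x y) = uea_gen x * uea_gen y - uea_gen y * uea_gen x.
Proof.
apply/(canRL (addrK _)).
have genM z t : uea_gen z * uea_gen t = upi (UMul (UGen z) (UGen t)).
  by rewrite upiM.
by rewrite !genM -[LHS]upiD; apply/upiP/UC_genB.
Qed.

End Uea.

Arguments uW [K L].

(* Lie algebra maps L -> A into an associative algebra (with its commutator   *)
(* bracket) and the algebra maps U(L) -> A extending them.                    *)

Record lierep (K : fieldType) (L : lieAlgType K) (A : algType K) := LieRep {
  lierep_fun :> {linear L -> A};
  lierepB : forall x y, lierep_fun (lie x y) =
    lierep_fun x * lierep_fun y - lierep_fun y * lierep_fun x
}.

Section UeaLift.
Context {K : fieldType} {L : lieAlgType K} {A : algType K} (f : lierep L A).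

Fixpoint ueval (t : uterm K L) : A :=
  match t with
  | UGen x => f x
  | UScal a => a%:A
  | UAdd s t => ueval s + ueval t
  | UMul s t => ueval s * ueval t
  end.

Lemma ueval_cong s t : ucong s t -> ueval s = ueval t.
Proof.
elim=> /=; try by intros; congruence.
- by move=> *; rewrite addrA.
- by move=> *; rewrite addrC.
- by move=> *; rewrite scale0r add0r.
- by move=> *; rewrite mulrA.
- by move=> *; rewrite scale1r mul1r.
- by move=> *; rewrite scale1r mulr1.
- by move=> *; rewrite scale0r mul0r.
- by move=> *; rewrite mulrDl.
- by move=> *; rewrite mulrDr.
- by move=> *; rewrite scalerDl.
- by move=> *; rewrite -scalerAl mul1r scalerA.
- by move=> *; rewrite -scalerAl -scalerAr mul1r mulr1.
- by move=> *; rewrite linearP -scalerAl mul1r.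
- by move=> *; rewrite lierepB subrK.
Qed.

Definition uea_lift (u : uea L) : A := ueval (urepr u).

Lemma uea_liftE t : uea_lift (upi t) = ueval t.
Proof. exact/ueval_cong/upi_repr. Qed.

Lemma uea_lift_gen x : uea_lift (uea_gen x) = f x.
Proof. exact: uea_liftE. Qed.

Fact uea_lift_linear : linear uea_lift.
Proof.
move=> a; elim/uW => s; elim/uW => t.
have -> : a *: upi s = upi (UMul (UScal a) s) by rewrite upiM.
have -> : upi (UMul (UScal a) s) + upi t = upi (UAdd (UMul (UScal a) s) t).
  by rewrite [RHS]upiD.
by rewrite !uea_liftE /= -scalerAl mul1r.
Qed.

HB.instance Definition _ :=
  GRing.isLinear.Build K (uea L) A _ uea_lift uea_lift_linear.

Fact uea_lift_monoid : monoid_morphism uea_lift.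
Proof.
split; first by rewrite [LHS]uea_liftE /= scale1r.
elim/uW => s; elim/uW => t.
have -> : upi s * upi t = upi (UMul s t) by rewrite upiM.
by rewrite !uea_liftE.
Qed.

HB.instance Definition _ :=
  GRing.isMonoidMorphism.Build (uea L) A uea_lift uea_lift_monoid.

End UeaLift.

Section ConverseAlgebra.
Context (K : fieldType) (A : algType K).

HB.instance Definition _ := GRing.Lmodule.copy (A^c) A.

Fact converse_scaleAl (a : K) (x y : A^c) :
  a *: (x * y) = (a *: x : A^c) * y.
Proof. exact: (@scalerAr K A). Qed.

HB.instance Definition _ :=
  GRing.Lmodule_isLalgebra.Build K (A^c) converse_scaleAl.

Fact converse_scaleAr (a : K) (x y : A^c) :
  a *: (x * y) = x * (a *: y : A^c).
Proof. exact: (@scalerAl K A). Qed.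

HB.instance Definition _ :=
  GRing.Lalgebra_isAlgebra.Build K (A^c) converse_scaleAr.

End ConverseAlgebra.

(* The tensor product B (x)_A N of the right A-module B (A acting through j)  *)
(* with a left A-module N, as a left B-module. A sequence of pairs (b, n)     *)
(* stands for the sum of the pure tensors b (x) n; opposites need not be      *)
(* added, as -(b (x) n) = (- b) (x) n.                                        *)

Section Tensor.
Context {A B : nzRingType} (j : {rmorphism A -> B}) (N : lmodType A).
Notation T := (seq (B * N)).

Inductive tcong : T -> T -> Prop :=
  | TC_refl s : tcong s s
  | TC_sym s t : tcong s t -> tcong t s
  | TC_trans s t u : tcong s t -> tcong t u -> tcong s u
  | TC_cat s s' t t' : tcong s s' -> tcong t t' -> tcong (s ++ t) (s' ++ t')
  | TC_catC s t : tcong (s ++ t) (t ++ s)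
  | TC_0 n : tcong [:: (0, n)] [::]
  | TC_Dl b b' n : tcong [:: (b + b', n)] [:: (b, n); (b', n)]
  | TC_Dr b n n' : tcong [:: (b, n + n')] [:: (b, n); (b, n')]
  | TC_balanced b a n : tcong [:: (b * j a, n)] [:: (b, a *: n)].

Definition tcongb : rel T := fun s t => `[< tcong s t >].

Fact tcongb_equiv : equiv_class_of tcongb.
Proof.
split=> [s|s t|t s u].
- by apply/asboolP; exact: TC_refl.
- by apply/asboolP/asboolP => h; exact: TC_sym.
- by move=> /asboolP h1 /asboolP h2; apply/asboolP; exact: TC_trans h1 h2.
Qed.

Canonical tcong_equiv := EquivRelPack tcongb_equiv.

Definition tensor := {eq_quot tcong_equiv}.

HB.instance Definition _ := Choice.on tensor.

Definition tpi (t : T) : tensor := \pi_({eq_quot tcong_equiv}) t.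

Lemma tpiP s t : tpi s = tpi t <-> tcong s t.
Proof. by split=> [/eqquotP/asboolP|h] //; apply/eqquotP/asboolP. Qed.

Definition trepr (u : tensor) : T := repr (u : {eq_quot tcong_equiv}).

Lemma treprK u : tpi (trepr u) = u.
Proof. exact: reprK. Qed.

Lemma tpi_repr t : tcong (trepr (tpi t)) t.
Proof. by apply/tpiP; rewrite treprK. Qed.

Definition tmul (b : B) (s : T) : T := [seq (b * p.1, p.2) | p <- s].

Lemma tmul_cong b s t : tcong s t -> tcong (tmul b s) (tmul b t).
Proof.
elim=> {s t} /=.
- by move=> *; exact: TC_refl.
- by move=> *; exact: TC_sym.
- by move=> s t u _ h1 _ h2; exact: TC_trans h1 h2.
- by move=> s s' t t' _ h1 _ h2; rewrite /tmul !map_cat; exact: TC_cat.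
- by move=> s t; rewrite /tmul !map_cat; exact: TC_catC.
- by move=> n; rewrite mulr0; exact: TC_0.
- by move=> c c' n; rewrite mulrDr; exact: TC_Dl.
- by move=> c n n'; exact: TC_Dr.
- by move=> c a n; rewrite mulrA; exact: TC_balanced.
Qed.

Definition tadd u v := tpi (trepr u ++ trepr v).
Definition tscale b u := tpi (tmul b (trepr u)).

Lemma tpiD s t : tpi (s ++ t) = tadd (tpi s) (tpi t).
Proof. by apply/tpiP/TC_sym/TC_cat; exact: tpi_repr. Qed.

Lemma tpiZ b s : tpi (tmul b s) = tscale b (tpi s).
Proof. by apply/tpiP/TC_sym/tmul_cong; exact: tpi_repr. Qed.

Lemma tW (P : tensor -> Prop) : (forall t, P (tpi t)) -> forall u, P u.
Proof. by move=> h u; rewrite -[u]treprK. Qed.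

Fact taddA : associative tadd.
Proof. by elim/tW => s; elim/tW => t; elim/tW => u; rewrite -!tpiD catA. Qed.

Fact taddC : commutative tadd.
Proof. by elim/tW => s; elim/tW => t; rewrite -!tpiD; apply/tpiP/TC_catC. Qed.

Fact tadd0 : left_id (tpi [::]) tadd.
Proof. by elim/tW => s; rewrite -tpiD. Qed.

Fact tscaleA b c u : tscale b (tscale c u) = tscale (b * c) u.
Proof.
elim/tW: u => s; rewrite -!tpiZ /tmul -map_comp; congr tpi.
by apply: eq_map => p /=; rewrite mulrA.
Qed.

Fact tscale1 : left_id 1 tscale.
Proof.
elim/tW => s; rewrite -tpiZ /tmul; congr tpi.
by rewrite -[RHS]map_id; apply: eq_map => -[b n] /=; rewrite mul1r.
Qed.

Fact tscaleDr : right_distributive tscale tadd.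
Proof.
by move=> b; elim/tW => s; elim/tW => t; rewrite -!(tpiD, tpiZ) /tmul map_cat.
Qed.

Fact tscaleDl u b c : tscale (b + c) u = tadd (tscale b u) (tscale c u).
Proof.
elim/tW: u => s; elim: s => [|[d n] s ih]; first by rewrite -!tpiZ -tpiD.
rewrite -cat1s tpiD !tscaleDr {}ih.
have -> : tscale (b + c) (tpi [:: (d, n)]) =
    tadd (tscale b (tpi [:: (d, n)])) (tscale c (tpi [:: (d, n)])).
  by rewrite -!tpiZ -tpiD /= mulrDl; apply/tpiP/TC_Dl.
by rewrite -!taddA; congr tadd; rewrite !taddA; congr tadd; rewrite taddC.
Qed.

Fact tscale0 u : tscale 0 u = tpi [::].
Proof.
elim/tW: u => s; elim: s => [|[d n] s ih]; first by rewrite -tpiZ.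
rewrite -cat1s tpiD tscaleDr ih -tpiZ /= mul0r.
by rewrite -tpiD cats0; apply/tpiP/TC_0.
Qed.

Fact taddN : left_inverse (tpi [::]) (tscale (-1)) tadd.
Proof. by move=> u; rewrite -{2}[u]tscale1 -tscaleDl addNr tscale0. Qed.

HB.instance Definition _ :=
  GRing.isZmodule.Build tensor taddA taddC tadd0 taddN.

Fact tscaleDl' u : {morph tscale^~ u : b c / b + c}.
Proof. by move=> b c; exact: tscaleDl. Qed.

HB.instance Definition _ := GRing.Zmodule_isLmodule.Build B tensor
  tscaleA tscale1 tscaleDr tscaleDl'.

Definition pure_tensor (b : B) (n : N) : tensor := tpi [:: (b, n)].

Lemma pure_tensorDl b b' n :
  pure_tensor (b + b') n = pure_tensor b n + pure_tensor b' n.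
Proof. by rewrite -[RHS]tpiD; apply/tpiP/TC_Dl. Qed.

Lemma pure_tensorDr b n n' :
  pure_tensor b (n + n') = pure_tensor b n + pure_tensor b n'.
Proof. by rewrite -[RHS]tpiD; apply/tpiP/TC_Dr. Qed.

Lemma pure_tensor_balanced b a n :
  pure_tensor (b * j a) n = pure_tensor b (a *: n).
Proof. by apply/tpiP/TC_balanced. Qed.

Lemma pure_tensorZ b c n : c *: pure_tensor b n = pure_tensor (c * b) n.
Proof. by rewrite [LHS](esym (tpiZ _ _)). Qed.

End Tensor.

(* The Heisenberg algebra over K, with parameter w in place of omega_1. Basis *)
(* indices: Some k stands for b_k and None for c.                             *)

Definition heis (K : numFieldType) (w : K) : Type := {malg K[option int]}.

Section Heisenberg.
Context {K : numFieldType} (w : K).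
Notation heis := (heis w).

HB.instance Definition _ := GRing.Lmodule.copy heis {malg K[option int]}.

Implicit Types (x y z : heis).

Definition hcoef (i : option int) (x : heis) : K := mcoeff i x.
Definition hsupp (x : heis) : seq (option int) := msupp x.
Definition hbasis (i : option int) : heis := << i >>.
Definition bgen (k : int) : heis := hbasis (Some k).
Definition cgen : heis := hbasis None.

Lemma hcoefP (x y : heis) : (forall i, hcoef i x = hcoef i y) -> x = y.
Proof. by move=> e; apply/malgP => i; exact: e. Qed.

Lemma hcoef_is_linear i : scalar (hcoef i).
Proof. by move=> a x y; rewrite /hcoef [LHS]mcoeffD [X in X + _]fgscaleE. Qed.

HB.instance Definition _ i :=
  GRing.isLinear.Build K heis K _ (hcoef i) (hcoef_is_linear i).

Lemma hcoef_basis i j : hcoef i (hbasis j) = (i == j)%:R.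
Proof. by rewrite /hcoef [LHS]mcoeffU eq_sym. Qed.

Lemma hsuppE i x : (i \in hsupp x) = (hcoef i x != 0).
Proof. by rewrite mcoeff_neq0. Qed.

Definition hext (V : lmodType K) (f : option int -> V) (x : heis) : V :=
  \sum_(i <- hsupp x) hcoef i x *: f i.

Lemma hext_is_linear (V : lmodType K) (f : option int -> V) : linear (hext f).
Proof.
move=> a x y; rewrite /hext.
pose E := (msupp (x : {malg _[_]}) `|` msupp (y : {malg _[_]})
  `|` msupp ((a *: x + y : heis) : {malg _[_]}))%fset.
have hE (z : heis) : (msupp (z : {malg _[_]}) `<=` E)%fset ->
    \sum_(i <- hsupp z) hcoef i z *: f i = \sum_(i <- E) hcoef i z *: f i.
  move=> zE; rewrite /hsupp (big_fset_incl _ zE) // => i _ /mcoeff_outdom.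
  by rewrite /hcoef => ->; rewrite scale0r.
rewrite !hE; try by apply/fsubsetP => i; rewrite !inE => ->; rewrite ?orbT.
rewrite scaler_sumr -big_split /=; apply: eq_bigr => i _.
by rewrite linearP scalerDl scalerA.
Qed.

HB.instance Definition _ (V : lmodType K) f :=
  GRing.isLinear.Build K heis V _ (@hext V f) (hext_is_linear f).

Lemma hext_basis (V : lmodType K) (f : option int -> V) i :
  hext f (hbasis i) = f i.
Proof.
have hE : (msupp (<< i >> : {malg K[option int]}) `<=` [fset i])%fset.
  exact: msuppU_le.
rewrite /hext /hsupp (big_fset_incl _ hE) => [|j _ /mcoeff_outdom]; last first.
  by rewrite /hcoef => ->; rewrite scale0r.
by rewrite big_seq_fset1 hcoef_basis eqxx scale1r.
Qed.

Lemma exchange_hext (V : lmodType K) (f : option int -> option int -> V) x y :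
  hext (fun i => hext (f i) y) x = hext (fun j => hext (f^~ j) x) y.
Proof.
rewrite /hext; under eq_bigr do rewrite scaler_sumr.
rewrite exchange_big; apply: eq_bigr => j _; rewrite scaler_sumr.
by apply: eq_bigr => i _; rewrite !scalerA mulrC.
Qed.

Lemma linear_hext (V W : lmodType K) (g : V -> W) f x :
  linear g -> g (hext f x) = hext (g \o f) x.
Proof.
move=> lg; pose G : {linear V -> W} :=
  HB.pack g (GRing.isLinear.Build K V W _ g lg).
rewrite -[g]/(G : V -> W) /hext linear_sum; apply: eq_bigr => i _.
by rewrite linearZ.
Qed.

(* [b_k, b_l] = k delta_{k+l,0} w c, and c is central *)
Definition hbracket0 (i j : option int) : heis :=
  match i, j with
  | Some k, Some l => (k%:~R * (k + l == 0)%:R * w) *: cgen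
  | _, _ => 0
  end.

Definition hbracket (x y : heis) : heis :=
  hext (fun i => hext (fun j => hbracket0 i j) y) x.

Fact hbracket_linearl z a x y :
  hbracket (a *: x + y) z = a *: hbracket x z + hbracket y z.
Proof. exact: linearP. Qed.

Fact hbracket_linearr z a x y :
  hbracket z (a *: x + y) = a *: hbracket z x + hbracket z y.
Proof.
rewrite /hbracket /hext scaler_sumr -big_split; apply: eq_bigr => i _ /=.
rewrite -!/(hext _ _) linearP scalerDr !scalerA.
by rewrite mulrC.
Qed.

Fact hbracket0C i j : hbracket0 i j = - hbracket0 j i.
Proof.
case: i j => [k|] [l|] /=; rewrite ?oppr0 // -scaleNr; congr (_ *: _).
rewrite (addrC l); have [kl|_] := eqVneq (k + l) 0; last first.
  by rewrite !(mulr0, mul0r) oppr0.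
by rewrite -(addr0_eq kl) mulrNz -!mulNr opprK.
Qed.

Fact hbracketC x y : hbracket x y = - hbracket y x.
Proof.
rewrite /hbracket /hext.
under eq_bigr do rewrite scaler_sumr.
rewrite exchange_big /= -sumrN; apply: eq_bigr => j _.
rewrite scaler_sumr -sumrN; apply: eq_bigr => i _.
by rewrite (hbracket0C i) !scalerN !scalerA mulrC.
Qed.

Fact hbracketxx x : hbracket x x = 0.
Proof.
have := hbracketC x x; move: (hbracket x x) => u uN.
have /eqP : 2%:R *: u = 0 by rewrite scaler_nat mulr2n {1}uN addNr.
by rewrite scaler_eq0 pnatr_eq0 /= => /eqP.
Qed.

Fact hbracket_span x y : exists a, hbracket x y = a *: cgen.
Proof.
pose P (z : heis) := exists a, z = a *: cgen.
have PD (u v : heis) : P u -> P v -> P (u + v).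
  by move=> [a ->] [b ->]; exists (a + b); rewrite scalerDl.
have P0 : P 0 by exists 0; rewrite scale0r.
apply: (big_ind P) => // i _; rewrite /hext scaler_sumr.
apply: (big_ind P) => // j _; case: i j => [k|] [l|] /=; rewrite ?scaler0 //.
by rewrite !scalerA; eexists.
Qed.

Fact hbracket_cgen x : hbracket x cgen = 0.
Proof.
by rewrite /hbracket {1}/hext big1 // => -[k|] _; rewrite hext_basis scaler0.
Qed.

Fact hbracket_jacobi x y z :
  hbracket x (hbracket y z) + hbracket y (hbracket z x)
    + hbracket z (hbracket x y) = 0.
Proof.
have nil u v t : hbracket u (hbracket v t) = 0.
  have [a ->] := hbracket_span v t.
  by rewrite -[_ *: _]addr0 hbracket_linearr hbracket_cgen scaler0 add0r
    [LHS]hbracketC [hbracket 0 u]linear0 oppr0.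
by rewrite !nil !addr0.
Qed.

HB.instance Definition _ := Lmodule_isLie.Build K heis
  hbracket_linearl hbracket_linearr hbracketxx hbracket_jacobi.

Lemma lie_bgen (k l : int) :
  lie (bgen k) (bgen l) = (k%:~R * (k + l == 0)%:R * w) *: cgen.
Proof. by rewrite [LHS]hext_basis hext_basis. Qed.

Lemma lie_cgen x : lie x cgen = 0.
Proof. exact: hbracket_cgen. Qed.

(* the linear span of the basis elements with index in P *)
Definition hspan_pred (P : pred (option int)) : {pred heis} :=
  [pred x | all P (hsupp x)].

Fact hspan_submod P : submod_closed (hspan_pred P).
Proof.
split=> [|a x y /allP hx /allP hy].
  by apply/allP => i; rewrite hsuppE linear0 eqxx.
apply/allP => i; rewrite hsuppE; apply: contraNT => Pi.
have z0 z : {in hsupp z, forall j, P j} -> hcoef i z = 0.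
  move=> hz; apply/eqP; apply: contraNT Pi => zi; apply: hz.
  by rewrite hsuppE.
by rewrite linearP /= (z0 x hx) (z0 y hy) mulr0 addr0.
Qed.

HB.instance Definition _ P :=
  GRing.isSubmodClosed.Build K heis (hspan_pred P) (hspan_submod P).

Record hspan (P : pred (option int)) := HSpan {
  hspan_val :> heis;
  hspan_valP : hspan_val \in hspan_pred P
}.

HB.instance Definition _ P := [isSub for @hspan_val P].
HB.instance Definition _ P := [Choice of hspan P by <:].
HB.instance Definition _ P := [SubChoice_isSubLmodule of hspan P by <:].

Lemma hspan_basisP (P : pred (option int)) i : P i -> hbasis i \in hspan_pred P.
Proof.
move=> Pi; apply/allP => j; rewrite hsuppE hcoef_basis.
by case: (eqVneq j i) => [->|] //; rewrite eqxx.
Qed.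

(* H_0 and H_+ (+) H_0 *)
Definition in_heis0 (i : option int) := if i is Some k then k == 0 else true.
Definition in_heisb (i : option int) := if i is Some k then 0 <= k else true.

Definition heis0 := hspan in_heis0.
HB.instance Definition _ := GRing.Lmodule.on heis0.
Definition b0_heis0 : heis0 := HSpan (@hspan_basisP in_heis0 (Some 0) isT).
Definition c_heis0 : heis0 := HSpan (@hspan_basisP in_heis0 None isT).

Definition heisb := hspan in_heisb.
HB.instance Definition _ := GRing.SubLmodule.on heisb.

Fact lie_heisb (x y : heisb) : lie (x : heis) (y : heis) \in hspan_pred in_heisb.
Proof.
have [a axy] := hbracket_span x y.
rewrite (_ : lie _ _ = a *: cgen) //; apply: rpredZ.
exact: (@hspan_basisP in_heisb None).
Qed.

Definition hblie (x y : heisb) : heisb := HSpan (lie_heisb x y).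

Fact hblie_linearl (z : heisb) a (x y : heisb) :
  hblie (a *: x + y) z = a *: hblie x z + hblie y z.
Proof. by apply: val_inj; rewrite linearP; exact: lie_linearl. Qed.

Fact hblie_linearr (z : heisb) a (x y : heisb) :
  hblie z (a *: x + y) = a *: hblie z x + hblie z y.
Proof. by apply: val_inj; rewrite linearP; exact: lie_linearr. Qed.

Fact hbliexx (x : heisb) : hblie x x = 0.
Proof. by apply: val_inj; exact: liexx. Qed.

Fact hblie_jacobi (x y z : heisb) :
  hblie x (hblie y z) + hblie y (hblie z x) + hblie z (hblie x y) = 0.
Proof. by apply: val_inj; rewrite !linearD; exact: lie_jacobi. Qed.

HB.instance Definition _ := Lmodule_isLie.Build K heisb
  hblie_linearl hblie_linearr hbliexx hblie_jacobi.

Definition heisb_to_uea (x : heisb) : uea heis := uea_gen (x : heis).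

Fact heisb_to_uea_linear : linear heisb_to_uea.
Proof. by move=> a x y; rewrite /heisb_to_uea -linearP. Qed.

HB.instance Definition _ :=
  GRing.isLinear.Build K heisb (uea heis) _ heisb_to_uea heisb_to_uea_linear.

Fact heisb_to_ueaB (x y : heisb) : heisb_to_uea (lie x y) =
  heisb_to_uea x * heisb_to_uea y - heisb_to_uea y * heisb_to_uea x.
Proof. exact: uea_genB. Qed.

Definition heisb_rep : lierep heisb (uea heis) := LieRep heisb_to_ueaB.

(* b_k |-> b_{-k}, c |-> c; it extends to the anti-automorphism omega, that   *)
(* is, to an algebra map from U(H) to the converse algebra of U(H).           *)
Definition hopp (i : option int) : heis :=
  if i is Some k then bgen (- k) else cgen.

Definition heis_flip (x : heis) : (uea heis)^c := uea_gen (hext hopp x).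

Fact heis_flip_linear : linear heis_flip.
Proof. by move=> a x y; rewrite /heis_flip !linearP. Qed.

HB.instance Definition _ :=
  GRing.isLinear.Build K heis ((uea heis)^c) _ heis_flip heis_flip_linear.

Fact hopp_bracket x y : hext hopp (lie x y) = lie (hext hopp y) (hext hopp x).
Proof.
rewrite (linear_hext _ _ (@linearP _ _ _ _ (hext hopp))).
rewrite (@linear_hext _ _ (fun u => lie u (hext hopp x))); last first.
  by move=> a u v; exact: lie_linearl.
pose F i j : heis := lie (hopp j) (hopp i).
have -> : hext ((fun u => lie u (hext hopp x)) \o hopp) y =
    hext (fun j => hext (F^~ j) x) y.
  apply: eq_bigr => j _; congr (_ *: _).
  rewrite /= (@linear_hext _ _ (lie (hopp j))) //.
  by move=> a u v; exact: lie_linearr.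
have -> : hext (hext hopp \o (fun i => hext (hbracket0 i) y)) x =
    hext (fun i => hext (F i) y) x.
  apply: eq_bigr => i _; congr (_ *: _).
  rewrite /= (linear_hext _ _ (@linearP _ _ _ _ (hext hopp))).
  apply: eq_bigr => j _; congr (_ *: _) => /=.
  case: i j => [k|] [l|] //=; rewrite /F /= ?linear0 ?lie_cgen //.
  - rewrite lie_bgen linearZ /= hext_basis; congr (_ *: _).
    rewrite -opprD oppr_eq0 (addrC l); have [kl|_] := eqVneq (k + l) 0.
      by rewrite -(addr0_eq kl) opprK.
    by rewrite !(mulr0, mul0r).
  - by rewrite [RHS]hbracketC hbracket_cgen oppr0.
exact: exchange_hext.
Qed.

Fact heis_flipB x y : heis_flip (lie x y) =
  heis_flip x * heis_flip y - heis_flip y * heis_flip x.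
Proof. by rewrite /heis_flip hopp_bracket uea_genB. Qed.

Definition heis_flip_rep : lierep heis ((uea heis)^c) := LieRep heis_flipB.

Definition omega (u : uea heis) : uea heis := uea_lift heis_flip_rep u.

Lemma omega1 : omega 1 = 1.
Proof. exact: (rmorph1 (uea_lift heis_flip_rep)). Qed.

Lemma omega_linear a u v : omega (a *: u + v) = a *: omega u + omega v.
Proof. exact: (linearP (uea_lift heis_flip_rep)). Qed.

Lemma omegaM u v : omega (u * v) = omega v * omega u.
Proof. exact: (rmorphM (uea_lift heis_flip_rep)). Qed.

Lemma omega_bgen k : omega (uea_gen (bgen k)) = uea_gen (bgen (- k)).
Proof. by rewrite [LHS]uea_lift_gen [LHS]/= /heis_flip hext_basis. Qed.

Lemma omega_cgen : omega (uea_gen cgen) = uea_gen cgen.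
Proof. by rewrite [LHS]uea_lift_gen [LHS]/= /heis_flip hext_basis. Qed.

Definition one_dim (phi : {scalar heis0}) : Type := K.

Section Verma.
Variable phi : {scalar heis0}.

(* the character of H_+ (+) H_0 vanishing on b_k (k > 0) and equal to phi on  *)
(* b_0 and c                                                                  *)
Definition hchar (x : heisb) : K^o :=
  hcoef (Some 0) x * phi b0_heis0 + hcoef None x * phi c_heis0.

Fact hchar_linear : linear hchar.
Proof.
move=> a x y.
have e i : hcoef i (a *: x + y : heisb) = a * hcoef i x + hcoef i y.
  by rewrite -[RHS]linearP.
by rewrite /hchar !e /GRing.scale /= !mulrDl mulrDr !mulrA addrACA.
Qed.

HB.instance Definition _ :=
  GRing.isLinear.Build K heisb K^o _ hchar hchar_linear.

Fact hcharB (x y : heisb) :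
  hchar (lie x y) = hchar x * hchar y - hchar y * hchar x.
Proof.
rewrite [in RHS]mulrC subrr (_ : lie x y = 0) ?linear0 //.
apply: val_inj => /=; apply: big1_seq => i /andP[_ xi].
rewrite /hext big1_seq ?scaler0 // => j /andP[_ yj].
have := allP (hspan_valP x) _ xi; have := allP (hspan_valP y) _ yj.
case: i j {xi yj} => [k|] [l|] /=; rewrite ?scaler0 // => l0 k0.
have [kl|_] := eqVneq (k + l) 0; last by rewrite mulr0 mul0r scale0r scaler0.
have -> : k = 0.
  by apply/eqP; rewrite eq_le k0 andbT -(lerD2r l) kl add0r.
by rewrite !mul0r scale0r scaler0.
Qed.

Definition hchar_rep : lierep heisb K^o := LieRep hcharB.

(* C_phi, as a left module over U(H_+ (+) H_0) *)
Notation one_dim := (one_dim phi).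
HB.instance Definition _ := GRing.Zmodule.copy one_dim K.

Definition one_dim_act (u : uea heisb) (z : one_dim) : one_dim :=
  uea_lift hchar_rep u * (z : K).

Fact one_dim_actA u v (z : one_dim) :
  one_dim_act u (one_dim_act v z) = one_dim_act (u * v) z.
Proof. by rewrite /one_dim_act rmorphM mulrA. Qed.

Fact one_dim_act1 : left_id 1 one_dim_act.
Proof. by move=> z; rewrite /one_dim_act rmorph1 mul1r. Qed.

Fact one_dim_actDr : right_distributive one_dim_act +%R.
Proof. by move=> u t z; rewrite /one_dim_act [LHS]mulrDr. Qed.

Fact one_dim_actDl (z : one_dim) : {morph one_dim_act^~ z : u v / u + v}.
Proof. by move=> u v; rewrite /one_dim_act rmorphD [LHS]mulrDl. Qed.

HB.instance Definition _ := GRing.Zmodule_isLmodule.Build (uea heisb) one_dim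
  one_dim_actA one_dim_act1 one_dim_actDr one_dim_actDl.

Definition verma : lmodType (uea heis) :=
  tensor (uea_lift heisb_rep) one_dim.

Definition vac : verma := pure_tensor (uea_lift heisb_rep) 1 (1 : one_dim).

Lemma uea_scalar_vac (a : K) :
  (a%:A : uea heis) *: vac = pure_tensor (uea_lift heisb_rep) 1 (a : one_dim).
Proof.
have e : a%:A * 1 = 1 * uea_lift heisb_rep a%:A :> uea heis.
  by rewrite mulr1 mul1r linearZ /= rmorph1.
rewrite /vac [LHS]pure_tensorZ e [LHS]pure_tensor_balanced; congr pure_tensor.
by rewrite [LHS]/(one_dim_act _ _) /one_dim_act linearZ /= rmorph1 mulr1
  [LHS]mulr1.
Qed.

Lemma heisb_vac (x : heisb) :
  uea_gen (x : heis) *: vac = ((hchar x)%:A : uea heis) *: vac.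
Proof.
rewrite uea_scalar_vac.
have e : uea_gen (x : heis) * 1 = 1 * uea_lift heisb_rep (uea_gen x).
  by rewrite mulr1 mul1r uea_lift_gen.
rewrite /vac [LHS]pure_tensorZ e [LHS]pure_tensor_balanced; congr pure_tensor.
by rewrite [LHS]/(one_dim_act _ _) /one_dim_act uea_lift_gen mulr1.
Qed.

End Verma.
End Heisenberg.

(* Partitions of n. Such a partition has at most n parts, each at most n, so  *)
(* bounded sequences over 'I_n.+1 lose nothing (intpart_of_seq).              *)

Definition is_intpart (n : nat) (s : seq nat) : bool :=
  [&& sorted geq s, all (leq 1) s & sumn s == n].

Definition intpart (n : nat) : Type :=
  {s : n.-bseq 'I_n.+1 | is_intpart n (map val s)}.
HB.instance Definition _ n := Finite.on (intpart n).

Definition parts (n : nat) (l : intpart n) : seq nat := map val (val l).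

(* zero unless 1 <= k <= n *)
Definition part_mult (n : nat) (l : intpart n) (k : nat) : nat :=
  count_mem k (parts l).

Lemma parts_inj n : injective (@parts n).
Proof. by move=> l m /(inj_map val_inj) /val_inj /val_inj. Qed.

Lemma intpart_of_seq n s : is_intpart n s -> exists l : intpart n, parts l = s.
Proof.
move=> sP; have /and3P[_ /allP s1 /eqP sn] := sP.
have le_n k : k \in s -> (k <= n)%N.
  by move=> ks; rewrite -sn sumnE (big_rem k ks) leq_addr.
have size_n : (size s <= n)%N.
  rewrite -sn; elim: s s1 {sP sn le_n} => //= k s ih s1.
  rewrite -add1n leq_add ?s1 ?mem_head // ih // => i si.
  by rewrite s1 // in_cons si orbT.
pose t := [seq inord k : 'I_n.+1 | k <- s].
have tE : map val t = s.
  rewrite -map_comp -[RHS]map_id; apply/eq_in_map => k ks /=.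
  by rewrite inordK // ltnS le_n.
have tn : (size t <= n)%N by rewrite size_map.
have tP : is_intpart n (map val (Bseq tn)) by rewrite tE.
by exists (exist _ (Bseq tn) tP).
Qed.

Definition irreducible_module (A : nzRingType) (M : lmodType A) : Prop :=
  (exists v : M, v != 0) /\
  forall N : {pred M}, submod_closed N -> N =i pred1 0 \/ N =i predT.

Section Shapovalov.
Context {K : numFieldType} {w : K} (phi : {scalar heis0 w}).
Notation M := (verma phi).

(* b_{-s_1} ... b_{-s_r} v_phi *)
Definition bvec (s : seq nat) : M :=
  foldr (fun k v => uea_gen (bgen w (- k%:Z)) *: v) (vac phi) s.

Definition pbw n (l : intpart n) : M := bvec (parts l).

(* M(phi)[-n]; K acts on M through the scalars a%:A of U(H) *)
Definition weight_space (n : nat) (x : M) : Prop :=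
  exists a : intpart n -> K, x = \sum_l (a l)%:A *: pbw l.

Record is_shapovalov (S : M -> M -> K) : Prop := IsShapovalov {
  shapovalovC : forall x y, S x y = S y x;
  shapovalovP : forall a x y z, S (a%:A *: x + y) z = a * S x z + S y z;
  shapovalov_vac : S (vac phi) (vac phi) = 1;
  shapovalov_omega : forall u x y, S (u *: x) y = S x (omega u *: y);
  shapovalov_graded : forall n n' x y, n != n' ->
    weight_space n x -> weight_space n' y -> S x y = 0
}.

(* the unique form satisfying is_shapovalov *)
Definition shapovalov : M -> M -> K :=
  xget (fun _ _ => 0) [set S | is_shapovalov S].

Definition nondegenerate_form (S : M -> M -> K) : Prop :=
  forall x, (forall y, S x y = 0) -> x = 0.

Definition gram (n : nat) : 'M[K]_#|{: intpart n}| :=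
  \matrix_(i, j) shapovalov (pbw (enum_val i)) (pbw (enum_val j)).

Definition shapovalov_regular : Prop :=
  forall n : nat, (1 <= n)%N -> \det (gram n) != 0.

End Shapovalov.

Arguments shapovalov {K w} phi.
Arguments is_shapovalov {K w} phi.
Arguments nondegenerate_form {K w phi} S.
Arguments weight_space {K w} phi.
Arguments bvec {K w} phi.
Arguments pbw {K w} phi {n}.
Arguments gram {K w} phi.

(* Main.v *)
From HB Require Import structures.
Require Import Defs.
From mathcomp Require Import all_boot all_order all_algebra.
From mathcomp Require Import finmap ring boolp classical_sets functions.
From mathcomp Require Import reals complex.

Set Implicit Arguments.
Unset Strict Implicit.
Unset Printing Implicit Defensive.

Import Order.TTheory GRing.Theory Num.Theory.

Local Open Scope ring_scope.
Local Open Scope complex_scope.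

(* U(H) acts on the formal power series in x_1, x_2, ... with b_{-k} acting   *)
(* as x_k and b_k as k omega_1 phi(c) d/dx_k (k > 0). The vector 1 is a       *)
(* highest weight vector of weight phi, so M(phi) maps to this Fock module    *)
(* and b_{-lambda} v goes to a monomial, hence is nonzero. If e denotes the   *)
(* constant term, then (u v, y) |-> e(omega(u) . image of y) is well defined  *)
(* and is the Shapovalov form. Since b_k b_{-lambda} v is                     *)
(* m_k(lambda) k omega_1 phi(c) times b_{-(lambda minus a part k)} v, the     *)
(* Gram matrices are diagonal with the stated entries. When phi(c) <> 0, take *)
(* a nonzero vector and let lambda have the largest number of parts among the *)
(* partitions in its expansion; then omega(b_{-lambda}) sends the vector to a *)
(* nonzero multiple of v, so every nonzero submodule contains v. Conversely   *)
(* the radical of the form is a submodule.                                    *)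

(** * Extending maps to U(L) and to tensor products *)

(** Everything rests on one formula, [bgen_bvec]: on PBW vectors, b_k acts as k omega_1 phi(c)
    d/dx_k acts on monomials. Iterated through [part_norm_cons], it yields [form_bvec]: for a
    normalized symmetric contravariant form the PBW vectors are orthogonal, with norms evaluated in
    [part_normE]; hence [gram_is_diag] and [det_gram]. The form exists because the Fock module
    supplies both a map out of M(phi), [to_fock], and a functional dual to it under omega,
    [vac_coef]; their pairing is [verma_form].

    The equivalences are proved as a cycle. The radical is a submodule without v
    ([irreducible_nondegenerate]). A vanishing norm would put a PBW vector, nonzero by [bvec_neq0],
    in the radical ([nondegenerate_regular]). The matrix G_1 has the single entry omega_1 phi(c)
    ([regular_charge_neq0]). Contraction by a longest partition recovers v from any nonzero vector
    ([annihilate_sum], [charge_neq0_irreducible]). *)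

Section UeaAction.
Context {K : fieldType} {L : lieAlgType K} {V : lmodType K}.
Context (rho : L -> V -> V).
Hypothesis rho_linearl : forall v, linear (rho^~ v).
Hypothesis rho_linearr : forall x, linear (rho x).
Hypothesis rhoB : forall x y v,
  rho (lie x y) v = rho x (rho y v) - rho y (rho x v).

(** Terms act on V directly, so that no algebra of endomorphisms of V has to be built. *)
Fixpoint uterm_act (t : uterm K L) (v : V) : V :=
  match t with
  | UGen x => rho x v
  | UScal a => a *: v
  | UAdd s t => uterm_act s v + uterm_act t v
  | UMul s t => uterm_act s (uterm_act t v)
  end.

Lemma uterm_act_linear t : linear (uterm_act t).
Proof.
elim: t => [x|a|s IHs t IHt|s IHs t IHt] c u v /=.
- exact: rho_linearr.
- by rewrite scalerDr !scalerA mulrC.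
- by rewrite IHs IHt scalerDr addrACA.
- by rewrite IHt IHs.
Qed.

Lemma uterm_actD t : {morph uterm_act t : u v / u + v}.
Proof. by move=> u v; have := uterm_act_linear t 1 u v; rewrite !scale1r. Qed.

Lemma uterm_act0 t : uterm_act t 0 = 0.
Proof. by have := uterm_act_linear t (-1) 0 0; rewrite !scaleN1r !addNr. Qed.

Lemma uterm_actZ t a v : uterm_act t (a *: v) = a *: uterm_act t v.
Proof. by have := uterm_act_linear t a v 0; rewrite uterm_act0 !addr0. Qed.

(** Each defining relation of U(L) holds for the action; right distributivity and centrality of
    scalars are where linearity of the operators enters. *)
Lemma uterm_act_cong s t : ucong s t -> uterm_act s = uterm_act t.
Proof.
elim=> /=; try by intros; congruence.
- by move=> s1 s2 t1 t2 _ e1 _ e2; apply/funext => v /=; rewrite e1 e2.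
- by move=> s1 s2 t1 t2 _ e1 _ e2; apply/funext => v /=; rewrite e1 e2.
- by move=> *; apply/funext => v /=; rewrite addrA.
- by move=> *; apply/funext => v /=; rewrite addrC.
- by move=> *; apply/funext => v /=; rewrite scale0r add0r.
- by move=> *; apply/funext => v /=; rewrite scale1r.
- by move=> *; apply/funext => v /=; rewrite scale1r.
- by move=> *; apply/funext => v /=; rewrite !scale0r.
- by move=> *; apply/funext => v /=; rewrite uterm_actD.
- by move=> *; apply/funext => v /=; rewrite scalerDl.
- by move=> *; apply/funext => v /=; rewrite scalerA.
- by move=> *; apply/funext => v /=; rewrite uterm_actZ.
- by move=> a x y; apply/funext => v /=; rewrite (rho_linearl v).
- by move=> *; apply/funext => v /=; rewrite rhoB subrK.
Qed.

Definition uact (u : uea L) (v : V) : V := uterm_act (urepr u) v.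

Lemma uactE t v : uact (upi t) v = uterm_act t v.
Proof. by rewrite /uact (uterm_act_cong (upi_repr t)). Qed.

Lemma uact_linear u : linear (uact u).
Proof. exact: uterm_act_linear. Qed.

Lemma uactZ u a v : uact u (a *: v) = a *: uact u v.
Proof. exact: uterm_actZ. Qed.

Lemma uact_gen x v : uact (uea_gen x) v = rho x v.
Proof. by rewrite uactE. Qed.

Lemma uactDl u u' v : uact (u + u') v = uact u v + uact u' v.
Proof.
elim/uW: u => s; elim/uW: u' => t.
have -> : upi s + upi t = upi (UAdd s t) by rewrite [RHS]upiD.
by rewrite !uactE.
Qed.

Lemma uactM u u' v : uact (u * u') v = uact u (uact u' v).
Proof.
elim/uW: u => s; elim/uW: u' => t.
have -> : upi s * upi t = upi (UMul s t) by rewrite [RHS]upiM.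
by rewrite !uactE.
Qed.

Lemma uact1 v : uact 1 v = v.
Proof. by rewrite [LHS]uactE /= scale1r. Qed.

Lemma uact_scal a v : uact (a%:A) v = a *: v.
Proof.
have -> : a%:A = upi (UScal a) :> uea L.
  rewrite -[LHS]/(upi (UScal a) * 1); exact: mulr1.
by rewrite uactE.
Qed.

End UeaAction.

Section UeaInduction.
Context {K : fieldType} {L : lieAlgType K}.

Lemma uea_ind (P : uea L -> Prop) :
  (forall x, P (uea_gen x)) -> (forall a, P a%:A) ->
  (forall u v, P u -> P v -> P (u + v)) ->
  (forall u v, P u -> P v -> P (u * v)) ->
  forall u, P u.
Proof.
move=> Pgen Pscal PD PM; elim/uW; elim=> [x|a|s Ps t Pt|s Ps t Pt].
- exact: Pgen.
- have -> : upi (UScal a) = a%:A :> uea L; last exact: Pscal.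
  rewrite -[RHS]/(upi (UScal a) * 1); exact/esym/mulr1.
- have -> : upi (UAdd s t) = upi s + upi t by rewrite [LHS]upiD.
  exact: PD.
- have -> : upi (UMul s t) = upi s * upi t by rewrite [LHS]upiM.
  exact: PM.
Qed.

End UeaInduction.

Section TensorLift.
Context {A B : nzRingType} {j : {rmorphism A -> B}} {N : lmodType A}.
Context {V : zmodType} (h : B -> N -> V).
Hypothesis hDl : forall b b' n, h (b + b') n = h b n + h b' n.
Hypothesis hDr : forall b n n', h b (n + n') = h b n + h b n'.
Hypothesis h_balanced : forall b a n, h (b * j a) n = h b (a *: n).

Definition tsum (t : seq (B * N)) : V := \sum_(p <- t) h p.1 p.2.

Lemma tsum_cong s t : tcong j s t -> tsum s = tsum t.
Proof.
rewrite /tsum; elim=> {s t} //.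
- by move=> s t u _ -> _ ->.
- by move=> s s' t t' _ e1 _ e2; rewrite !big_cat e1 e2.
- by move=> s t; rewrite !big_cat; exact: addrC.
(* h 0 n = 0, by cancelling h 0 n in h (0 + 0) n = h 0 n + h 0 n. *)
- move=> n; rewrite big_seq1 big_nil /=.
  by apply: (addIr (h 0 n)); rewrite -hDl !add0r.
- by move=> b b' n; rewrite !big_cons !big_nil /= !addr0 hDl.
- by move=> b n n'; rewrite !big_cons !big_nil /= !addr0 hDr.
- by move=> b a n; rewrite !big_seq1 h_balanced.
Qed.

Definition tlift (x : tensor j N) : V := tsum (trepr x).

Lemma tlift_pi t : tlift (tpi j t) = tsum t.
Proof. exact/tsum_cong/tpi_repr. Qed.

Lemma tlift_pure b n : tlift (pure_tensor j b n) = h b n.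
Proof. by rewrite [LHS]tlift_pi /tsum big_seq1. Qed.

Lemma tliftD x y : tlift (x + y) = tlift x + tlift y.
Proof.
elim/(@tW _ _ j N): x => s; elim/(@tW _ _ j N): y => t.
have -> : tpi j s + tpi j t = tpi j (s ++ t) by rewrite [RHS]tpiD.
by rewrite !tlift_pi /tsum big_cat.
Qed.

Lemma tlift0 : tlift 0 = 0.
Proof. by rewrite [LHS]tlift_pi /tsum big_nil. Qed.

End TensorLift.

Section TensorInduction.
Context {A B : nzRingType} {j : {rmorphism A -> B}} {N : lmodType A}.

Lemma tensor_ind (P : tensor j N -> Prop) :
  P 0 -> (forall b n x, P x -> P (pure_tensor j b n + x)) -> forall x, P x.
Proof.
move=> P0 PD; elim/(@tW _ _ j N); elim=> [|[b n] t Pt]; first exact: P0.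
have -> : tpi j ((b, n) :: t) = pure_tensor j b n + tpi j t.
  by rewrite -cat1s [LHS]tpiD.
exact: PD.
Qed.

End TensorInduction.

(** * The Fock module *)

Lemma hext_hbasis (K : numFieldType) (w : K) (x : heis w) :
  x = hext (hbasis w) x.
Proof.
apply: hcoefP => i.
rewrite (@linear_hext _ _ _ K^o (hcoef i)); last exact: hcoef_is_linear.
have -> : hcoef i \o hbasis w = (fun j => (i == j)%:R : K^o).
  by apply/funext => j /=; rewrite hcoef_basis.
rewrite /hext; have [ix|] := boolP (i \in hsupp x); last first.
  rewrite hsuppE negbK => /eqP xi0; rewrite xi0 big1 // => j _.
  have [<-|_] := eqVneq i j; first by rewrite xi0 scale0r.
  exact: scaler0.
rewrite (bigD1_seq i) //=; last exact: fset_uniq.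
rewrite eqxx big1 ?addr0; last first.
  by move=> j /negPf; rewrite eq_sym => ->; exact: scaler0.
by rewrite [_ *: _]mulr1.
Qed.

Lemma eq_linear_heis (K : numFieldType) (w : K) (V : lmodType K)
    (g h : heis w -> V) :
  linear g -> linear h -> (forall i, g (hbasis w i) = h (hbasis w i)) -> g =1 h.
Proof.
move=> lg lh gh x; rewrite (hext_hbasis x).
rewrite (linear_hext _ _ lg) (linear_hext _ _ lh).
by apply: eq_bigr => i _ /=; rewrite gh.
Qed.

Section Fock.
Context {K : numFieldType} (w b0 c0 : K).

(* Coefficient functions of formal power series in variables x_1, x_2, ... : *)
(* f m is the coefficient of the monomial with x_k occurring m k times.      *)
Definition fock := (nat -> nat) -> K^o.
HB.instance Definition _ := GRing.Lmodule.on fock.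
Implicit Types (f : fock) (m : nat -> nat).

Definition incr k m : nat -> nat := fun j => (m j + (j == k))%N.
Definition decr k m : nat -> nat := fun j => (m j - (j == k))%N.

Lemma incr_eq k m : incr k m k = (m k).+1.
Proof. by rewrite /incr eqxx addn1. Qed.

Lemma incr_neq k j m : j != k -> incr k m j = m j.
Proof. by move=> /negPf jk; rewrite /incr jk addn0. Qed.

Lemma decr_eq k m : decr k m k = (m k).-1.
Proof. by rewrite /decr eqxx subn1. Qed.

Lemma decr_neq k j m : j != k -> decr k m j = m j.
Proof. by move=> /negPf jk; rewrite /decr jk subn0. Qed.

Lemma incrK k m : decr k (incr k m) = m.
Proof. by apply/funext => j; rewrite /decr /incr addnK. Qed.

Lemma decrK k m : (0 < m k)%N -> incr k (decr k m) = m.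
Proof.
move=> mk; apply/funext => j; rewrite /decr /incr subnK //.
by case: eqP => [->|].
Qed.

Lemma incrC k l m : incr k (incr l m) = incr l (incr k m).
Proof. by apply/funext => j; rewrite /incr addnAC. Qed.

Lemma decrC k l m : decr k (decr l m) = decr l (decr k m).
Proof. by apply/funext => j; rewrite /decr subnAC. Qed.

Lemma incr_decrC k l m : k != l -> incr k (decr l m) = decr l (incr k m).
Proof.
move=> /negPf kl; apply/funext => j; rewrite /incr /decr.
by have [->|_] := eqVneq j k; rewrite ?kl ?subn0 // !addn0.
Qed.

(* x_k for the creation operators b_{-k}, k w c0 d/dx_k for b_k, k > 0 *)
Definition fock_op (i : option int) (f : fock) : fock :=
  match i with
  | None => c0 *: f
  | Some (Posz 0) => b0 *: f
  | Some (Posz k.+1) =>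
      fun m => k.+1%:R * w * c0 * (m k.+1).+1%:R * f (incr k.+1 m)
  | Some (Negz k) => fun m => if (0 < m k.+1)%N then f (decr k.+1 m) else 0
  end.

Lemma fock_op_linear i : linear (fock_op i).
Proof.
case: i => [[[|k]|k]|] a f g; apply/funext => m /=.
- by rewrite scalerDr !scalerA mulrC.
- by rewrite [LHS]mulrDr; congr (_ + _); rewrite /GRing.scale /= mulrCA.
- rewrite -[RHS]/(a * (if (0 < m k.+1)%N then f (decr k.+1 m) else 0) +
    (if (0 < m k.+1)%N then g (decr k.+1 m) else 0) : K).
  by case: ifP => // _; rewrite mulr0 addr0.
- by rewrite scalerDr !scalerA mulrC.
Qed.

Lemma fock_opZ i a f : fock_op i (a *: f) = a *: fock_op i f.
Proof.
have := fock_op_linear i a f 0.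
have -> : fock_op i 0 = 0.
  by have := fock_op_linear i (-1) 0 0; rewrite !scaleN1r !addNr.
by rewrite !addr0.
Qed.

(** The product rule: at the coefficient of x^m, d/dx_k x_k contributes m_k + 1 and x_k d/dx_k
    contributes m_k, so that 1 is left. *)
Lemma fock_opC k l f :
  fock_op (Some (Posz k.+1)) (fock_op (Some (Negz l)) f) =
  fock_op (Some (Negz l)) (fock_op (Some (Posz k.+1)) f)
    + (k.+1%:R * (k == l)%:R * w * c0) *: f.
Proof.
apply/funext => m; rewrite /fock_op.
rewrite -[RHS]/((if (0 < m l.+1)%N then k.+1%:R * w * c0 *
  (decr l.+1 m k.+1).+1%:R * f (incr k.+1 (decr l.+1 m)) else 0) +
  (k.+1%:R * (k == l)%:R * w * c0) * f m).
have [<-|kl] := eqVneq k l.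
  rewrite incr_eq /= incrK decr_eq mulr1.
  case: ifP => [mk|/negbT]; last first.
    by rewrite lt0n negbK => /eqP ->; rewrite mulr1 add0r.
  rewrite decrK //; case: (m k.+1) mk => // n _.
  by rewrite /= [n.+2%:R]mulrSr mulrDr mulr1 mulrDl.
have kl1 : k.+1 != l.+1 by rewrite eqSS.
rewrite incr_neq 1?eq_sym // decr_neq // incr_decrC // mulr0 !mul0r addr0.
by case: ifP => // _; rewrite mulr0.
Qed.

(** Only an annihilation operator paired with a creation operator can give a nonzero commutator, and
    that is [fock_opC]. Two operators of the same kind commute, and b_0 and c act by scalars. *)
Lemma fock_op_bracket0 i j f :
  fock_op i (fock_op j f) - fock_op j (fock_op i f) =
  (if (i, j) is (Some k, Some l) then k%:~R * (k + l == 0)%:R * w * c0 else 0)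
    *: f.
Proof.
have fzero g : g - g = 0 *: f by rewrite subrr scale0r.
have zl g (h : fock -> fock) : (forall a u, h (a *: u) = a *: h u) ->
  forall a, a *: h g - h (a *: g) = 0 *: f.
  by move=> hZ a; rewrite hZ fzero.
have zr g (h : fock -> fock) : (forall a u, h (a *: u) = a *: h u) ->
  forall a, h (a *: g) - a *: h g = 0 *: f.
  by move=> hZ a; rewrite hZ fzero.
case: i j => [k|] [l|]; last 1 first.
- exact: fzero.
- case: k l => [[|k]|k] [[|l]|l].
  + by rewrite fzero !mul0r.
  + by rewrite [LHS](zl _ (fock_op _) (@fock_opZ _)) !mul0r.
  + by rewrite [LHS](zl _ (fock_op _) (@fock_opZ _)) !mul0r.
  + rewrite addr0 mulr0 !mul0r.
    exact: (zr _ (fock_op _) (@fock_opZ (Some (Posz k.+1)))).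
  + rewrite mulr0 !mul0r; have [->|kl] := eqVneq k l; first exact: fzero.
    rewrite -[RHS](fzero (fock_op (Some (Posz k.+1))
      (fock_op (Some (Posz l.+1)) f))); congr (_ - _).
    apply/funext => m; rewrite /fock_op (incrC k.+1) !mulrA; congr (_ * _).
    rewrite !incr_neq ?eqSS // 1?eq_sym //; ring.
  + rewrite fock_opC addrAC subrr add0r; congr (_ *: _).
    by congr (_ * _%:R * _ * _); rewrite NegzE subr_eq0.
  + rewrite addr0 mulr0 !mul0r.
    exact: (zr _ (fock_op _) (@fock_opZ (Some (Negz k)))).
  + rewrite -opprB fock_opC addrAC subrr add0r -scaleNr; congr (_ *: _).
    rewrite NegzE addrC subr_eq0 eqz_nat eqSS; have [->|_] := eqVneq l k.
      by rewrite mulrNz !mulNr.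
    by rewrite !mulr0 !mul0r oppr0.
  + rewrite mulr0 !mul0r; have [->|kl] := eqVneq k l; first exact: fzero.
    rewrite -[RHS](fzero (fock_op (Some (Negz k))
      (fock_op (Some (Negz l)) f))); congr (_ - _).
    apply/funext => m; rewrite /fock_op (decrC k.+1).
    by rewrite !decr_neq ?eqSS // 1?eq_sym //; do 2 case: ifP.
- exact: (zr _ (fock_op (Some k)) (@fock_opZ _)).
- exact: (zl _ (fock_op (Some l)) (@fock_opZ _)).
Qed.

Definition fock_rep (x : heis w) (f : fock) : fock :=
  hext (fun i => fock_op i f) x.

Lemma fock_rep_linearl f : linear (fock_rep^~ f).
Proof. by move=> a x y; rewrite /fock_rep linearP. Qed.

Lemma fock_rep_linearr x : linear (fock_rep x).
Proof.
move=> a f g; rewrite /fock_rep /hext scaler_sumr -big_split.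
apply: eq_bigr => i _ /=.
by rewrite fock_op_linear scalerDr !scalerA [a * _]mulrC.
Qed.

Lemma fock_rep_basis i f : fock_rep (hbasis w i) f = fock_op i f.
Proof. exact: hext_basis. Qed.

Lemma fock_repB x y f :
  fock_rep (lie x y) f =
    fock_rep x (fock_rep y f) - fock_rep y (fock_rep x f).
Proof.
have linB (g h : heis w -> fock) : linear g -> linear h ->
    linear (fun x => g x - h x).
  by move=> lg lh a u v; rewrite lg lh opprD addrACA scalerBr.
move: x; apply: eq_linear_heis => [a u v||i].
- by rewrite lie_linearl fock_rep_linearl.
- apply: linB => a u v; first by rewrite fock_rep_linearl.
  by rewrite fock_rep_linearl fock_rep_linearr.
move: y; apply: eq_linear_heis => [a u v||j].
- by rewrite lie_linearr fock_rep_linearl.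
- apply: linB => a u v; last by rewrite fock_rep_linearl.
  by rewrite fock_rep_linearl fock_rep_linearr.
rewrite !fock_rep_basis fock_op_bracket0.
have -> : lie (hbasis w i) (hbasis w j) = hbracket0 w i j.
  by rewrite [LHS]hext_basis hext_basis.
case: i j => [k|] [l|] /=; try by rewrite /fock_rep linear0 scale0r.
by rewrite /fock_rep linearZ /= hext_basis scalerA.
Qed.

Definition fock_act : uea (heis w) -> fock -> fock := uact fock_rep.

Lemma fock_actDl u v f : fock_act (u + v) f = fock_act u f + fock_act v f.
Proof. exact: uactDl fock_rep_linearl fock_rep_linearr fock_repB _ _ _. Qed.

Lemma fock_actM u v f : fock_act (u * v) f = fock_act u (fock_act v f).
Proof. exact: uactM fock_rep_linearl fock_rep_linearr fock_repB _ _ _. Qed.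

Lemma fock_act1 f : fock_act 1 f = f.
Proof. exact: uact1 fock_rep_linearl fock_rep_linearr fock_repB _. Qed.

Lemma fock_act_scal a f : fock_act a%:A f = a *: f.
Proof. exact: uact_scal fock_rep_linearl fock_rep_linearr fock_repB _ _. Qed.

Lemma fock_act_gen x f : fock_act (uea_gen x) f = fock_rep x f.
Proof. exact: uact_gen fock_rep_linearl fock_rep_linearr fock_repB _ _. Qed.

Lemma fock_act_bgen k f : fock_act (uea_gen (bgen w k)) f = fock_op (Some k) f.
Proof. by rewrite fock_act_gen fock_rep_basis. Qed.

Lemma fock_act_linear u : linear (fock_act u).
Proof. exact: uact_linear fock_rep_linearr _. Qed.

Lemma fock_actZ u a f : fock_act u (a *: f) = a *: fock_act u f.
Proof. exact: uactZ fock_rep_linearr _ _ _. Qed.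

Definition fock_vac : fock := fun m => `[< m = (fun=> 0%N) >]%:R.

Definition fock_const (f : fock) : K := f (fun=> 0%N).

Lemma fock_constD f g : fock_const (f + g) = fock_const f + fock_const g.
Proof. by []. Qed.

Lemma fock_constZ a f : fock_const (a *: f) = a * fock_const f.
Proof. by []. Qed.

(** The character of H_+ + H_0 on basis indices, extended by zero to negative k so that [hext]
    applies to it. *)
Definition fock_char (i : option int) : K^o :=
  match i with None => c0 | Some k => if k == 0 then b0 else 0 end.

Lemma fock_op_vac i : in_heisb i ->
  fock_op i fock_vac = (fock_char i : K) *: fock_vac.
Proof.
case: i => [[[|k]|k]|] //= _; rewrite scale0r; apply/funext => m.
rewrite /fock_vac asboolF ?mulr0 // => /(congr1 (fun g => g k.+1)).
by rewrite incr_eq.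
Qed.

(** Dual to [fock_op_vac]: for k > 0, omega(b_k) = b_{-k} multiplies by x_k and leaves no constant
    term. *)
Lemma fock_const_op i f : in_heisb i ->
  fock_const (fock_rep (hopp w i) f) = fock_char i * fock_const f.
Proof.
case: i => [[[|k]|k]|] //= _; rewrite fock_rep_basis //=.
by rewrite mul0r.
Qed.

End Fock.

(** * The form on the Verma module *)

Section VermaForm.
Context {K : numFieldType} {w : K} (phi : {scalar heis0 w}).
Notation M := (verma phi).
Notation b0 := (phi (b0_heis0 w)).
Notation c0 := (phi (c_heis0 w)).
Notation fock := (@fock K).
Notation fact := (fock_act (w := w) b0 c0).
Notation vacF := (@fock_vac K).

Lemma omegaD (u v : uea (heis w)) : omega (u + v) = omega u + omega v.
Proof. by rewrite -[u]scale1r omega_linear !scale1r. Qed.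

Lemma omega_scal (a : K) : omega (a%:A : uea (heis w)) = a%:A.
Proof.
have omega0 : omega (0 : uea (heis w)) = 0.
  by apply: (addIr (omega 0)); rewrite -omegaD !add0r.
by rewrite -[a%:A]addr0 omega_linear omega1 omega0.
Qed.

Lemma hcharE (x : heisb w) : hchar phi x = hext (fock_char b0 c0) (x : heis w).
Proof.
pose g (y : heis w) : K^o := hcoef (Some 0) y * b0 + hcoef None y * c0.
have lg : linear g.
  move=> a u v; rewrite -[RHS]/(a * g u + g v : K) /g !hcoef_is_linear.
  ring.
rewrite -[LHS]/(g x); move: (x : heis w); apply: eq_linear_heis => // [|i].
  exact: linearP.
rewrite hext_basis /g !hcoef_basis.
case: i => [k|] /=; last by rewrite mul0r mul1r add0r.
by rewrite -[Some 0 == Some k]/(0 == k) eq_sym mul0r addr0;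
  case: (k == 0); rewrite (mul1r, mul0r).
Qed.

Lemma fock_act_vac (a : uea (heisb w)) :
  fact (uea_lift (heisb_rep w) a) vacF
    = (uea_lift (hchar_rep phi) a : K) *: vacF.
Proof.
elim/(@uea_ind K (heisb w)): a => [x|a|u v IHu IHv|u v IHu IHv].
- rewrite !uea_lift_gen fock_act_gen -[hchar_rep phi x]/(hchar phi x) hcharE.
  rewrite /fock_rep /hext scaler_suml; apply: eq_big_seq => i xi.
  by rewrite fock_op_vac ?scalerA // (allP (hspan_valP x)).
- by rewrite !linearZ /= !rmorph1 fock_act_scal [_ *: 1]mulr1.
- by rewrite !linearD /= fock_actDl IHu IHv scalerDl.
- rewrite !rmorphM /= fock_actM IHv.
  by rewrite fock_actZ IHu scalerA [X in X *: _]mulrC.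
Qed.

(** The series f stays general in the induction: omega reverses products, so the hypothesis on v is
    used at the series omega(u) f. *)
Lemma fock_const_act (a : uea (heisb w)) f :
  fock_const (fact (omega (uea_lift (heisb_rep w) a)) f)
    = (uea_lift (hchar_rep phi) a : K) * fock_const f.
Proof.
elim/(@uea_ind K (heisb w)): a f => [x|a|u v IHu IHv|u v IHu IHv] f.
- rewrite !uea_lift_gen -[hchar_rep phi x]/(hchar phi x) hcharE.
  rewrite [omega _]uea_lift_gen fock_act_gen.
  have -> : fock_rep b0 c0 (hext (hopp w) (x : heis w)) f =
      hext (fun i => fock_rep b0 c0 (hopp w i) f) (x : heis w).
    exact: linear_hext (hopp w) (x : heis w) (fock_rep_linearl b0 c0 f).
  rewrite /hext /fock_const fct_sumE mulr_suml; apply: eq_big_seq => i xi.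
  have e := @fock_const_op K w b0 c0 i f (allP (hspan_valP x) _ xi).
  rewrite -[LHS]/(hcoef i x * fock_const (fock_rep b0 c0 (hopp w i) f)) e.
  exact: mulrA.
- by rewrite !linearZ /= !rmorph1 omega_scal fock_act_scal [_ *: 1]mulr1.
- by rewrite !linearD /= omegaD fock_actDl fock_constD IHu IHv mulrDl.
- by rewrite !rmorphM /= omegaM fock_actM IHv IHu mulrCA mulrA.
Qed.

Lemma one_dimE (a : uea (heisb w)) (n : one_dim phi) :
  a *: n = (uea_lift (hchar_rep phi) a : K) * n :> K.
Proof. by []. Qed.

Definition to_fock_fun (b : uea (heis w)) (n : one_dim phi) : fock :=
  (n : K) *: fact b vacF.

Definition to_fock (x : M) : fock := tlift to_fock_fun x.

Lemma to_fock_funDl c d n :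
  to_fock_fun (c + d) n = to_fock_fun c n + to_fock_fun d n.
Proof. by rewrite /to_fock_fun fock_actDl scalerDr. Qed.

Lemma to_fock_funDr b y z :
  to_fock_fun b (y + z) = to_fock_fun b y + to_fock_fun b z.
Proof. by rewrite /to_fock_fun -scalerDl. Qed.

Lemma to_fock_fun_balanced b a n :
  to_fock_fun (b * uea_lift (heisb_rep w) a) n = to_fock_fun b (a *: n).
Proof.
rewrite /to_fock_fun fock_actM fock_act_vac fock_actZ scalerA one_dimE.
by rewrite [in RHS]mulrC.
Qed.

Lemma to_fockD x y : to_fock (x + y) = to_fock x + to_fock y.
Proof. exact: tliftD to_fock_funDl to_fock_funDr to_fock_fun_balanced _ _. Qed.

Lemma to_fock0 : to_fock 0 = 0.
Proof. exact: tlift0 to_fock_funDl to_fock_funDr to_fock_fun_balanced. Qed.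

Lemma to_fock_pure b n :
  to_fock (pure_tensor (uea_lift (heisb_rep w)) b n) = (n : K) *: fact b vacF.
Proof.
exact: tlift_pure to_fock_funDl to_fock_funDr to_fock_fun_balanced _ _.
Qed.

Lemma to_fockZ u (x : M) : to_fock (u *: x) = fact u (to_fock x).
Proof.
elim/(@tensor_ind _ _ (uea_lift (heisb_rep w)) (one_dim phi)): x
  => [|b n x IHx].
  by rewrite scaler0 to_fock0 -[X in fact u X](scale0r (0 : fock)) fock_actZ
    scale0r.
rewrite scalerDr !to_fockD IHx [u *: _]pure_tensorZ !to_fock_pure.
rewrite fock_actM -fock_actZ.
by rewrite -[X in fact u (X + _)]scale1r fock_act_linear scale1r.
Qed.

Lemma to_fock_vac : to_fock (vac phi) = vacF.
Proof. by rewrite [LHS]to_fock_pure fock_act1 scale1r. Qed.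

(* vac_coef f (u v_phi) is the constant term of omega(u) f; balancedness      *)
(* holds because b_{-k} (k > 0) kills constant terms.                         *)
Definition vac_coef_fun (f : fock) (b : uea (heis w)) (n : one_dim phi) : K :=
  (n : K) * fock_const (fact (omega b) f).

Definition vac_coef (f : fock) (x : M) : K := tlift (vac_coef_fun f) x.

Lemma vac_coef_funDl f c d n :
  vac_coef_fun f (c + d) n = vac_coef_fun f c n + vac_coef_fun f d n.
Proof. by rewrite /vac_coef_fun omegaD fock_actDl fock_constD mulrDr. Qed.

Lemma vac_coef_funDr f b y z :
  vac_coef_fun f b (y + z) = vac_coef_fun f b y + vac_coef_fun f b z.
Proof. by rewrite /vac_coef_fun -mulrDl. Qed.

Lemma vac_coef_fun_balanced f b a n :
  vac_coef_fun f (b * uea_lift (heisb_rep w) a) n = vac_coef_fun f b (a *: n).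
Proof.
by rewrite /vac_coef_fun omegaM fock_actM fock_const_act one_dimE mulrCA mulrA.
Qed.

Lemma vac_coefD f x y : vac_coef f (x + y) = vac_coef f x + vac_coef f y.
Proof.
exact: tliftD (vac_coef_funDl f) (vac_coef_funDr f)
  (vac_coef_fun_balanced f) _ _.
Qed.

Lemma vac_coef0 f : vac_coef f 0 = 0.
Proof.
exact: tlift0 (vac_coef_funDl f) (vac_coef_funDr f)
  (vac_coef_fun_balanced f).
Qed.

Lemma vac_coef_pure f b n :
  vac_coef f (pure_tensor (uea_lift (heisb_rep w)) b n)
    = (n : K) * fock_const (fact (omega b) f).
Proof.
exact: tlift_pure (vac_coef_funDl f) (vac_coef_funDr f)
  (vac_coef_fun_balanced f) _ _.
Qed.

Lemma vac_coefZ f u (x : M) :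
  vac_coef f (u *: x) = vac_coef (fact (omega u) f) x.
Proof.
elim/(@tensor_ind _ _ (uea_lift (heisb_rep w)) (one_dim phi)): x
  => [|b n x IHx].
  by rewrite scaler0 !vac_coef0.
rewrite scalerDr !vac_coefD IHx [u *: _]pure_tensorZ !vac_coef_pure.
by rewrite omegaM fock_actM.
Qed.

Lemma vac_coef_linear a f g x :
  vac_coef (a *: f + g) x = a * vac_coef f x + vac_coef g x.
Proof.
elim/(@tensor_ind _ _ (uea_lift (heisb_rep w)) (one_dim phi)): x
  => [|b n x IHx].
  by rewrite !vac_coef0 mulr0 addr0.
rewrite !vac_coefD IHx !vac_coef_pure fock_act_linear fock_constD fock_constZ.
ring.
Qed.

Lemma vac_coef0l x : vac_coef 0 x = 0.
Proof.
have := vac_coef_linear 1 0 0 x; rewrite scaler0 addr0 mul1r => e.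
by apply: (addIr (vac_coef 0 x)); rewrite add0r -e.
Qed.

Lemma vac_coef_vac f : vac_coef f (vac phi) = fock_const f.
Proof. by rewrite [LHS]vac_coef_pure omega1 fock_act1 mul1r. Qed.

(** Contravariance is built in, by [vac_coefZ] and [to_fockZ]. Symmetry is not visible from this
    formula; it is [verma_formC]. *)
Definition verma_form (x y : M) : K := vac_coef (to_fock y) x.

Lemma verma_form_linearl a x y z :
  verma_form ((a%:A : uea (heis w)) *: x + y) z
    = a * verma_form x z + verma_form y z.
Proof.
rewrite /verma_form vac_coefD vac_coefZ omega_scal fock_act_scal.
by rewrite -[a *: _]addr0 vac_coef_linear vac_coef0l addr0.
Qed.

Lemma verma_form_linearr a x y z :
  verma_form x ((a%:A : uea (heis w)) *: y + z)
    = a * verma_form x y + verma_form x z.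
Proof.
by rewrite /verma_form to_fockD to_fockZ fock_act_scal vac_coef_linear.
Qed.

Lemma verma_form_omega u x y :
  verma_form (u *: x) y = verma_form x (omega u *: y).
Proof. by rewrite /verma_form vac_coefZ to_fockZ. Qed.

Lemma verma_form_vac : verma_form (vac phi) (vac phi) = 1.
Proof.
rewrite /verma_form vac_coef_vac to_fock_vac /fock_const /fock_vac.
by rewrite asboolT.
Qed.

Lemma to_fock_bvec s : all (leq 1) s ->
  to_fock (bvec phi s) (fun j => count_mem j s) = 1.
Proof.
elim: s => [|[//|k] s IHs] /= => [_|/IHs {}IHs].
  by rewrite to_fock_vac /fock_vac asboolT.
rewrite to_fockZ fock_act_bgen.
rewrite -[LHS]/(if (0 < (k.+1 == k.+1) + count_mem k.+1 s)%N then
  to_fock (bvec phi s) (decr k.+1 (fun j => (k.+1 == j) + count_mem j s)%N)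
  else 0) eqxx -[RHS]IHs; congr (to_fock _ _).
by apply/funext => j; rewrite /decr eq_sym addKn.
Qed.

(** Read off from a monomial in the Fock module, hence valid also when phi(c) = 0, where the form no
    longer separates vectors. *)
Lemma bvec_neq0 s : all (leq 1) s -> bvec phi s <> 0.
Proof.
move=> /to_fock_bvec e s0; move: e; rewrite s0 to_fock0 => /esym/eqP.
by rewrite oner_eq0.
Qed.

End VermaForm.

(** * Action on the PBW vectors *)

Section VermaBasis.
Context {K : numFieldType} {w : K} (phi : {scalar heis0 w}).
Notation M := (verma phi).
Notation b0 := (phi (b0_heis0 w)).
Notation c0 := (phi (c_heis0 w)).
Notation U := (uea (heis w)).
Notation gen := (@uea_gen K (heis w)).
Notation b k := (gen (bgen w k)).
Notation bvec := (bvec phi).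
Implicit Types (x y v : M) (u : U) (s t : seq nat).

Lemma uscalC (a : K) u v : u *: ((a%:A : U) *: v) = (a%:A : U) *: (u *: v).
Proof. by rewrite !scalerA -scalerAr -scalerAl mulr1 mul1r. Qed.

Lemma uscalM (a a' : K) v :
  (a%:A : U) *: ((a'%:A : U) *: v) = ((a * a')%:A : U) *: v.
Proof. by rewrite scalerA -scalerAl mul1r scalerA. Qed.

Lemma uscalDl (a a' : K) v :
  ((a + a')%:A : U) *: v = (a%:A : U) *: v + (a'%:A : U) *: v.
Proof. by rewrite !scalerDl. Qed.

Lemma uscal0 v : ((0 : K)%:A : U) *: v = 0.
Proof. by rewrite !scale0r. Qed.

Lemma uscal1 v : ((1 : K)%:A : U) *: v = v.
Proof. by rewrite !scale1r. Qed.

Lemma gen_scal (a : K) (z : heis w) v :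
  gen (a *: z) *: v = (a%:A : U) *: (gen z *: v).
Proof. by rewrite linearZ /= [RHS]scalerA -scalerAl mul1r. Qed.

Lemma gen_comm (z t : heis w) v :
  gen z *: (gen t *: v) = gen t *: (gen z *: v) + gen (lie z t) *: v.
Proof. by rewrite uea_genB scalerBl !scalerA addrC subrK. Qed.

Lemma basis_vac i : in_heisb i ->
  gen (hbasis w i) *: vac phi = ((fock_char b0 c0 i)%:A : U) *: vac phi.
Proof.
move=> ib; have := heisb_vac phi (HSpan (@hspan_basisP K w in_heisb i ib)).
by rewrite hcharE /= hext_basis.
Qed.

Lemma cgen_bvec s : gen (cgen w) *: bvec s = (c0%:A : U) *: bvec s.
Proof.
elim: s => [|k s IHs] /=; first exact: (@basis_vac None).
rewrite gen_comm IHs uscalC.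
have -> : lie (cgen w) (bgen w (- k%:Z)) = 0.
  by rewrite [LHS]hext_basis /hext big1 // => i _; exact: scaler0.
by rewrite linear0 scale0r addr0.
Qed.

Lemma bgen_comm (k l : int) s : b k *: (b l *: bvec s) = b l *: (b k *: bvec s)
  + ((k%:~R * (k + l == 0)%:R * w * c0)%:A : U) *: bvec s.
Proof. by rewrite gen_comm lie_bgen gen_scal cgen_bvec uscalM. Qed.

Lemma bgen0_bvec s : b 0 *: bvec s = (b0%:A : U) *: bvec s.
Proof.
elim: s => [|k s IHs] /=; first exact: (@basis_vac (Some 0)).
by rewrite bgen_comm IHs uscalC !mul0r uscal0 addr0.
Qed.

(** The central term carries the factor -k and requires k + l = 0; for natural numbers this forces k
    = 0, so it always vanishes. *)
Lemma bvec_swap k l s : bvec [:: k, l & s] = bvec [:: l, k & s].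
Proof.
rewrite /= bgen_comm -opprD oppr_eq0.
rewrite [X in X%:A](_ : _ = 0) ?uscal0 ?addr0 //.
by case: k l => [|k] [|l] //=; rewrite ?mulr0 !mul0r.
Qed.

Lemma bvec_rem k s : k \in s -> bvec (k :: rem k s) = bvec s.
Proof.
elim: s => // l s IHs; rewrite inE /=.
have [->|lk] := eqVneq l k => // ks.
rewrite -[LHS]/(bvec [:: k, l & rem k s]) bvec_swap /=.
by rewrite -[X in _ *: X]/(bvec (k :: rem k s)) IHs.
Qed.

Lemma bvec_perm s t : perm_eq s t -> bvec s = bvec t.
Proof.
elim: s t => [|k s IHs] t; first by rewrite perm_sym => /perm_nilP ->.
move=> st; have kt : k \in t by rewrite -(perm_mem st) mem_head.
rewrite -(bvec_rem kt) /= (IHs (rem k t)) // -(perm_cons k).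
exact: perm_trans st (perm_to_rem kt).
Qed.

(** Moving b_k to the right until it kills v leaves one central term for each part equal to k. If k
    is not in s, [rem k s] is s and the coefficient is 0. *)
Lemma bgen_bvec k s : (0 < k)%N ->
  b k%:Z *: bvec s = (((count_mem k s)%:R * (k%:R * w * c0))%:A : U)
    *: bvec (rem k s).
Proof.
case: k => // k _; elim: s => [|l s IHs] /=.
  by rewrite mul0r uscal0 [LHS](@basis_vac (Some k.+1%:Z)) // uscal0.
rewrite bgen_comm IHs uscalC subr_eq0 eqz_nat eq_sym.
have [->|lk] := eqVneq l k.+1; last by rewrite add0n mulr0 !mul0r uscal0 addr0.
rewrite -[_ *: bvec (rem _ _)]/(bvec (k.+1 :: rem k.+1 s)) mulr1.
rewrite natrD mulrDl mul1r addrC uscalDl; congr (_ + _).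
(* Without a part k + 1 in s the two vectors differ, but both coefficients are zero. *)
have [/bvec_rem -> //|/count_memPn ->] := boolP (k.+1 \in s).
by rewrite mul0r !uscal0.
Qed.

End VermaBasis.

(** A nonincreasing sequence is determined by its multiset of entries. The list [r] carries the
    sortedness, as the support of an expansion does. *)
Lemma perm_sorted_eq (r : seq (seq nat)) s t :
  all (sorted geq) r -> s \in r -> t \in r -> perm_eq s t = (s == t).
Proof.
move=> /allP rs sr tr; apply/idP/eqP => [|-> //].
apply: sorted_eq (rs _ sr) (rs _ tr) => [y x z|x y]; rewrite /geq /=.
  by move=> yx zy; exact: leq_trans zy yx.
by rewrite andbC; exact: anti_leq.
Qed.

(** * Iterated contractions and the norms of PBW vectors *)

Section Contraction.
Context {K : numFieldType} {w : K} (phi : {scalar heis0 w}).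
Notation M := (verma phi).
Notation c0 := (phi (c_heis0 w)).
Notation U := (uea (heis w)).
Notation gen := (@uea_gen K (heis w)).
Notation b k := (gen (bgen w k)).
Notation bvec := (bvec phi).
Notation vac := (vac phi).
Implicit Types (x y v : M) (u : U) (s t : seq nat).

(** The action of omega(b_{-s_1} ... b_{-s_r}): b_{s_1} comes first, since omega reverses the
    product. *)
Fixpoint annihilate s x : M :=
  if s is k :: s' then annihilate s' (b k%:Z *: x) else x.

(* S(b_{-s} v, b_{-s} v), accumulated one contraction at a time *)
Fixpoint part_norm s : K :=
  if s is k :: s' then
    (count_mem k s)%:R * (k%:R * w * c0) * part_norm s'
  else 1.

Lemma annihilate_linear s a x y :
  annihilate s ((a%:A : U) *: x + y)
    = (a%:A : U) *: annihilate s x + annihilate s y.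
Proof.
elim: s x y => //= k s IHs x y.
by rewrite scalerDr uscalC IHs.
Qed.

Lemma annihilate0 s : annihilate s 0 = 0.
Proof. by elim: s => //= k s IHs; rewrite scaler0. Qed.

Lemma annihilateZ s a x :
  annihilate s ((a%:A : U) *: x) = (a%:A : U) *: annihilate s x.
Proof. by rewrite -[_ *: x]addr0 annihilate_linear annihilate0 addr0. Qed.

Lemma annihilateD s x y :
  annihilate s (x + y) = annihilate s x + annihilate s y.
Proof. by rewrite -[x]uscal1 annihilate_linear !uscal1. Qed.

Lemma all_rem (k : nat) (p : pred nat) s : all p s -> all p (rem k s).
Proof. by move/allP => ps; apply/allP => x /mem_rem /ps. Qed.

Lemma perm_eq_rem k s t : k \in t -> perm_eq (k :: s) t = perm_eq s (rem k t).
Proof. by move=> kt; rewrite (permPr (perm_to_rem kt)) perm_cons. Qed.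

(** One contraction step, shared by [annihilate_bvec] and [form_bvec]. If k is not in t both sides
    vanish; if the sequences match, k has the same multiplicity in t and in k :: s. *)
Lemma part_norm_cons k s t :
  (count_mem k t)%:R * (k%:R * w * c0) * (part_norm s *+ perm_eq s (rem k t))
    = part_norm (k :: s) *+ perm_eq (k :: s) t.
Proof.
have [kt|kt] := boolP (k \in t); last first.
  rewrite (count_memPn kt) !mul0r [perm_eq (_ :: _) _](_ : _ = false) //.
  by apply: contraNF kt => /perm_mem <-; exact: mem_head.
rewrite perm_eq_rem //; have [st|_] := boolP (perm_eq s (rem k t)).
  have -> : count_mem k t = count_mem k (k :: s).
    by apply/esym/permP; rewrite perm_eq_rem.
  by rewrite /= eqxx.
by rewrite mulr0.
Qed.

(** Each contraction removes a part of t or gives zero. As t is no longer than s, a surviving term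
    has used up all of t and is a multiple of v. *)
Lemma annihilate_bvec s t : all (leq 1) s -> (size t <= size s)%N ->
  annihilate s (bvec t) = ((part_norm s *+ perm_eq s t)%:A : U) *: vac.
Proof.
elim: s t => [|k s IHs] t.
  by move=> _; rewrite leqn0 => /nilP ->; rewrite uscal1.
move=> /= /andP[k0 s0] ts; rewrite bgen_bvec // annihilateZ.
have [kt|/count_memPn kt] := boolP (k \in t); last first.
  by rewrite -[_ * part_norm s]/(part_norm (k :: s)) -part_norm_cons kt !mul0r
    !uscal0.
rewrite IHs ?size_rem // ?uscalM ?part_norm_cons //.
by rewrite -ltnS (leq_trans _ ts) // ltn_predL; case: (t) kt.
Qed.

Section InvariantForm.
Context (S : M -> M -> K).
Hypothesis S_linearr : forall a x y z,
  S x ((a%:A : U) *: y + z) = a * S x y + S x z.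
Hypothesis S_vac : S vac vac = 1.
Hypothesis S_omega : forall u x y, S (u *: x) y = S x (omega u *: y).

Lemma invariant_form0r x : S x 0 = 0.
Proof.
have := S_linearr 1 x 0 0; rewrite scaler0 addr0 mul1r => e.
by apply: (addIr (S x 0)); rewrite add0r -e.
Qed.

Lemma form_bgen k x y : S (b (- k%:Z) *: x) y = S x (b k%:Z *: y).
Proof. by rewrite S_omega omega_bgen opprK. Qed.

Lemma form_vac_bvec t : all (leq 1) t -> S (bvec t) vac = (t == [::])%:R.
Proof.
case: t => [|k t] /= => [_|/andP[k0 _]]; first exact: S_vac.
by rewrite form_bgen -[vac]/(bvec [::]) bgen_bvec //= mul0r uscal0
  invariant_form0r.
Qed.

(** Assumed only from here on, because the two preceding lemmas serve to prove the symmetry of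
    [verma_form]. *)
Hypothesis SC : forall t, all (leq 1) t -> S vac (bvec t) = S (bvec t) vac.

Lemma form_bvec s t : all (leq 1) s -> all (leq 1) t ->
  S (bvec s) (bvec t) = part_norm s *+ perm_eq s t.
Proof.
elim: s t => [|k s IHs] t /=.
  by move=> _ t0; rewrite SC // form_vac_bvec // perm_sym (sameP perm_nilP eqP).
move=> /andP[k0 s0] t0; rewrite form_bgen bgen_bvec //.
rewrite -[_ *: _]addr0 S_linearr invariant_form0r addr0 IHs ?all_rem //.
exact: part_norm_cons.
Qed.

End InvariantForm.

(** The successive multiplicities of a part k in the recursion are m_k, m_k - 1, ..., 1, and
    multiply to m_k!. Values of k that do not occur contribute 1. *)
Lemma part_normE n s : all (fun k => 1 <= k <= n)%N s ->
  part_norm s = \prod_(1 <= k < n.+1)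
    ((k%:R * w * c0) ^+ count_mem k s * (count_mem k s)`!%:R).
Proof.
elim: s => [_|k s IHs /= /andP[kn sn]].
  by rewrite big1 // => k _; rewrite expr0 mulr1.
have kr : k \in index_iota 1 n.+1 by rewrite mem_index_iota ltnS.
rewrite IHs // !(bigD1_seq k kr (iota_uniq _ _)) /= eqxx add1n [LHS]mulrA.
congr (_ * _); last first.
  by apply: eq_bigr => j /negPf jk; rewrite eq_sym jk add0n.
rewrite exprS factS natrM; ring.
Qed.

End Contraction.

(** * Spanning, Gram matrices and irreducibility *)

Lemma exists_maximal (T : eqType) (f : T -> nat) (r : seq T) : r != [::] ->
  exists2 x, x \in r & forall y, y \in r -> (f y <= f x)%N.
Proof.
elim: r => // x r IHr _; have [->|/IHr[y yr y_max]] := eqVneq r [::].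
  by exists x => [|y]; rewrite ?mem_head // inE => /eqP ->.
have [xy|yx] := leqP (f x) (f y).
  exists y => [|z]; rewrite inE ?yr ?orbT // => /predU1P[->//|].
  exact: y_max.
exists x => [|z]; rewrite inE ?eqxx // => /predU1P[->//|/y_max zy].
exact: leq_trans zy (ltnW yx).
Qed.

Section Spanning.
Context {K : numFieldType} {w : K} (phi : {scalar heis0 w}).
Notation M := (verma phi).
Notation U := (uea (heis w)).
Notation gen := (@uea_gen K (heis w)).
Notation bvec := (bvec phi).
Implicit Types (x y v : M) (u : U) (s t : seq nat).

Definition sorted_parts s := sorted geq s && all (leq 1) s.

Lemma sort_parts s : all (leq 1) s -> sorted_parts (sort geq s).
Proof. by move=> s0; rewrite /sorted_parts sort_sorted ?all_sort. Qed.

Definition in_span x : Prop := exists r : seq (K * seq nat),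
  all (fun p => sorted_parts p.2) r
    /\ x = \sum_(p <- r) (p.1%:A : U) *: bvec p.2.

Lemma in_span0 : in_span 0.
Proof. by exists [::]; rewrite big_nil. Qed.

Lemma in_spanD x y : in_span x -> in_span y -> in_span (x + y).
Proof.
move=> [r [r0 ->]] [r' [r0' ->]]; exists (r ++ r'); rewrite all_cat r0 r0'.
by rewrite big_cat.
Qed.

Lemma in_spanZ a x : in_span x -> in_span ((a%:A : U) *: x).
Proof.
move=> [r [r0 ->]]; exists [seq (a * p.1, p.2) | p <- r]; rewrite all_map.
split=> //; rewrite big_map scaler_sumr; apply: eq_bigr => p _.
by rewrite uscalM.
Qed.

Lemma in_span_bvec s : all (leq 1) s -> in_span (bvec s).
Proof.
move=> s0; exists [:: (1, sort geq s)].
rewrite /= sort_parts // big_seq1 uscal1.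
by split=> //; apply/bvec_perm; rewrite perm_sym perm_sort.
Qed.

Lemma in_span_gen_bvec i s :
  all (leq 1) s -> in_span (gen (hbasis w i) *: bvec s).
Proof.
move=> s0; case: i => [[[|k]|k]|].
- by rewrite bgen0_bvec; apply/in_spanZ/in_span_bvec.
- by rewrite bgen_bvec //; apply/in_spanZ/in_span_bvec/all_rem.
- exact: (@in_span_bvec (k.+1 :: s)).
- by rewrite cgen_bvec; apply/in_spanZ/in_span_bvec.
Qed.

Lemma in_span_gen (z : heis w) x : in_span x -> in_span (gen z *: x).
Proof.
move=> [r [/allP r0 ->]]; rewrite scaler_sumr big_seq.
apply: (big_ind in_span) => [||p /r0 /andP[_ p0]].
- exact: in_span0.
- exact: in_spanD.
rewrite uscalC; apply: in_spanZ.
have -> : gen z = hext (fun i => gen (hbasis w i)) z.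
  by rewrite [in LHS](hext_hbasis z); apply: linear_hext; exact: linearP.
rewrite /hext scaler_suml; apply: (big_ind in_span) => [||i _].
- exact: in_span0.
- exact: in_spanD.
have -> : hcoef i z *: gen (hbasis w i) *: bvec p.2
    = ((hcoef i z)%:A : U) *: (gen (hbasis w i) *: bvec p.2).
  by rewrite scalerA -scalerAl mul1r.
by apply/in_spanZ/in_span_gen_bvec.
Qed.

Lemma in_span_uea u x : in_span x -> in_span (u *: x).
Proof.
elim/(@uea_ind K (heis w)): u x => [z|a|u u' IHu IHu'|u u' IHu IHu'] x xs.
- exact: in_span_gen.
- exact: in_spanZ.
- by rewrite scalerDl; apply: in_spanD; [exact: IHu|exact: IHu'].
- by rewrite -scalerA; apply/IHu/IHu'.
Qed.

(** The spanning half of PBW: the span contains v and is stable under U(H), and v generates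
    M(phi). *)
Lemma in_spanT x : in_span x.
Proof.
elim/(@tensor_ind _ _ (uea_lift (heisb_rep w)) (one_dim phi)): x
  => [|u n x IHx].
  exact: in_span0.
apply: in_spanD => //.
rewrite -[u]mulr1 -[pure_tensor _ _ _]pure_tensorZ -uea_scalar_vac.
by apply/in_span_uea/in_spanZ; exact: (@in_span_bvec [::]).
Qed.

Lemma bvec_expansion x : exists (r : seq (seq nat)) (a : seq nat -> K),
  [/\ uniq r, all sorted_parts r & x = \sum_(s <- r) ((a s)%:A : U) *: bvec s].
Proof.
have [r [/allP r0 ->]] := in_spanT x.
exists (undup [seq p.2 | p <- r]), (fun s => \sum_(p <- r | p.2 == s) p.1).
split; first exact: undup_uniq.
  by apply/allP => s; rewrite mem_undup => /mapP[p /r0 p0 ->].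
(* The inner sum has the single index s = p.2; exchanging the two sums then collects the
   coefficients of each sequence. *)
have -> : \sum_(p <- r) (p.1%:A : U) *: bvec p.2 =
    \sum_(p <- r) \sum_(s <- undup [seq p.2 | p <- r] | p.2 == s)
      (p.1%:A : U) *: bvec s.
  rewrite [LHS]big_seq [RHS]big_seq; apply: eq_bigr => p pr.
  rewrite -big_filter (_ : filter _ _ = [:: p.2]) ?big_seq1 //.
  rewrite (eq_filter (a2 := pred1 p.2)); last by move=> s; rewrite /= eq_sym.
  by rewrite filter_pred1_uniq ?undup_uniq // mem_undup map_f.
rewrite (exchange_big_dep xpredT) //=; apply: eq_bigr => s _.
by rewrite !scaler_suml.
Qed.

End Spanning.

(** * The Shapovalov form, its Gram matrices and the cycle of implications *)

Section Shapovalov.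
Context {K : numFieldType} {w : K} (phi : {scalar heis0 w}).
Notation M := (verma phi).
Notation c0 := (phi (c_heis0 w)).
Notation U := (uea (heis w)).
Notation bvec := (bvec phi).
Notation vac := (vac phi).
Notation S := (shapovalov phi).
Implicit Types (x y v : M) (u : U) (s t : seq nat).

(** Checked on PBW vectors. With at least one part, one side vanishes because b_k kills v, the other
    because a multiple of x_k has no constant term. *)
Lemma verma_form_vacr x : verma_form vac x = verma_form x vac.
Proof.
have [r [r0 ->]] := in_spanT x.
elim: r r0 => [_|p r IHr /= /andP[/andP[_ p0] r0]].
  rewrite big_nil (invariant_form0r (@verma_form_linearr _ _ phi)).
  by rewrite /verma_form vac_coef0.
rewrite big_cons verma_form_linearl verma_form_linearr IHr //.
congr (_ * _ + _).
rewrite (form_vac_bvec (@verma_form_linearr _ _ phi)) ?verma_form_vac //;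
  last exact: verma_form_omega.
rewrite /verma_form vac_coef_vac; case: (p.2) p0 => [|[//|k] s] _.
  by rewrite to_fock_vac /fock_const /fock_vac asboolT.
by rewrite [bvec _]/= to_fockZ fock_act_bgen.
Qed.

Lemma verma_form_bvec s t : all (leq 1) s -> all (leq 1) t ->
  verma_form (bvec s) (bvec t) = part_norm phi s *+ perm_eq s t.
Proof.
apply: form_bvec => *.
- exact: verma_form_linearr.
- exact: verma_form_vac.
- exact: verma_form_omega.
- exact: verma_form_vacr.
Qed.

Lemma parts_sorted_parts n (l : intpart n) : sorted_parts (parts l).
Proof. by rewrite /sorted_parts; have /and3P[-> ->] := valP l. Qed.

Lemma parts_ge1 n (l : intpart n) : all (leq 1) (parts l).
Proof. by have /andP[] := parts_sorted_parts l. Qed.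

Lemma sumn_parts n (l : intpart n) : sumn (parts l) = n.
Proof. by have /and3P[_ _ /eqP] := valP l. Qed.

Lemma perm_parts n (l m : intpart n) : perm_eq (parts l) (parts m) = (l == m).
Proof.
rewrite (@perm_sorted_eq [:: parts l; parts m]) ?mem_head ?inE ?eqxx ?orbT //.
  exact: inj_eq (@parts_inj n) _ _.
by rewrite /= !(andP (parts_sorted_parts _)).1.
Qed.

(** With x a PBW vector, its factors are carried across one at a time: b_{-k} becomes b_k on y, the
    induction hypothesis swaps the arguments, and contravariance restores b_{-k}. The base case is
    [verma_form_vacr]. *)
Lemma verma_formC x y : verma_form x y = verma_form y x.
Proof.
have [r [r0 ->]] := in_spanT x.
elim: r r0 => [_|p r IHr /= /andP[_ r0]].
  rewrite big_nil (invariant_form0r (@verma_form_linearr _ _ phi)).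
  by rewrite /verma_form vac_coef0.
rewrite big_cons verma_form_linearl verma_form_linearr IHr //.
congr (_ * _ + _).
elim: (p.2) y {IHr} => [|k s IHs] y; first exact: verma_form_vacr.
rewrite /= (form_bgen (@verma_form_omega _ _ phi)) IHs.
by rewrite [LHS]verma_form_omega omega_bgen.
Qed.

Lemma verma_form_graded n n' x y : n != n' ->
  weight_space phi n x -> weight_space phi n' y -> verma_form x y = 0.
Proof.
have sum0 v m (a : intpart m -> K) :
    (forall l : intpart m, verma_form v (pbw phi l) = 0) ->
    verma_form v (\sum_l ((a l)%:A : U) *: pbw phi l) = 0.
  move=> v0; elim/big_rec: _ => [|l z _ z0].
    exact: (invariant_form0r (@verma_form_linearr _ _ phi)).
  by rewrite verma_form_linearr z0 v0 mulr0 addr0.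
move=> nn' [a ->] [a' ->]; apply: (sum0) => l'; rewrite verma_formC.
apply: sum0 => l; rewrite verma_form_bvec ?parts_ge1 //.
have -> // : perm_eq (parts l') (parts l) = false.
apply: contraNF nn' => /perm_sumn; rewrite !sumn_parts => ->.
exact: eqxx.
Qed.

(** [xget] returns a member of an inhabited set, and [verma_form] is a member. *)
Lemma is_shapovalov_shapovalov : is_shapovalov phi S.
Proof.
apply: (@xgetPex _ (fun _ _ => 0) [set S | is_shapovalov phi S]).
exists (@verma_form _ _ phi); split.
- exact: verma_formC.
- exact: verma_form_linearl.
- exact: verma_form_vac.
- exact: verma_form_omega.
- exact: verma_form_graded.
Qed.

Lemma shapovalov_linearr a x y z :
  S x ((a%:A : U) *: y + z) = a * S x y + S x z.
Proof.
have sS := is_shapovalov_shapovalov.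
by rewrite !(shapovalovC sS x) (shapovalovP sS).
Qed.

Lemma shapovalov_bvec s t : all (leq 1) s -> all (leq 1) t ->
  S (bvec s) (bvec t) = part_norm phi s *+ perm_eq s t.
Proof.
have sS := is_shapovalov_shapovalov.
apply: form_bvec => *.
- exact: shapovalov_linearr.
- exact: shapovalov_vac.
- exact: shapovalov_omega.
- exact: shapovalovC.
Qed.

Lemma gramE n i j :
  gram phi n i j = part_norm phi (parts (enum_val i)) *+ (i == j).
Proof.
rewrite mxE shapovalov_bvec ?parts_ge1 // perm_parts.
by rewrite (inj_eq enum_val_inj).
Qed.

Lemma gram_is_diag n : is_diag_mx (gram phi n).
Proof.
by apply/is_diag_mxP => i j /negPf ij; rewrite gramE -val_eqE /= ij.
Qed.

Lemma det_gram_part_norm n :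
  \det (gram phi n) = \prod_(l : intpart n) part_norm phi (parts l).
Proof.
rewrite det_trig ?is_diag_mx_is_trig ?gram_is_diag //.
rewrite [RHS](big_enum_val (A := {: intpart n})) /=.
by apply: eq_bigr => i _; rewrite gramE eqxx.
Qed.

Lemma det_gram n : \det (gram phi n) =
  \prod_(l : intpart n) \prod_(1 <= k < n.+1)
    ((k%:R * w * c0) ^+ part_mult l k * (part_mult l k)`!%:R).
Proof.
rewrite det_gram_part_norm; apply: eq_bigr => l _; apply: part_normE.
apply/allP => k kl; rewrite (allP (parts_ge1 l)) //=.
by rewrite -[leqRHS](sumn_parts l) sumnE (big_rem k kl) leq_addr.
Qed.

Lemma part_norm_neq0 s : w != 0 -> c0 != 0 -> all (leq 1) s ->
  part_norm phi s != 0.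
Proof.
move=> w0 c0_neq0; elim: s => [_|k s IHs /= /andP[k0 s0]].
  exact: oner_neq0.
by rewrite !mulf_neq0 ?IHs // ?pnatr_eq0 ?eqxx // -lt0n.
Qed.

Lemma irreducible_nondegenerate :
  irreducible_module M -> nondegenerate_form (shapovalov phi).
Proof.
have sS := is_shapovalov_shapovalov.
move=> [_ irrM] x x0.
pose N : {pred M} := [pred v | `[< forall y, S v y = 0 >]].
have Nsub : submod_closed N.
  split=> [|u v v' /asboolP v0 /asboolP v'0]; apply/asboolP => y.
    by rewrite (shapovalovC sS) (invariant_form0r shapovalov_linearr).
  rewrite -[_ *: v]uscal1 (shapovalovP sS) mul1r (shapovalov_omega sS).
  by rewrite v0 v'0 addr0.
have [N0|NT] := irrM N Nsub.
  by apply/eqP; rewrite -[_ == _]N0; apply/asboolP.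
have /asboolP/(_ vac) : vac \in N by rewrite NT.
by rewrite (shapovalov_vac sS) => /eqP; rewrite oner_eq0.
Qed.

Lemma nondegenerate_regular :
  nondegenerate_form (shapovalov phi) -> shapovalov_regular phi.
Proof.
move=> nd n _; rewrite det_gram_part_norm; apply/prodf_neq0 => l _.
(* A PBW vector of norm zero is orthogonal to all PBW vectors, hence lies in the radical. *)
apply/eqP => l0; apply: (bvec_neq0 (parts_ge1 l)); apply: nd => y.
have [r [r0 ->]] := in_spanT y.
elim: r r0 => [_|p r IHr /= /andP[/andP[_ p0] r0]].
  by rewrite big_nil (invariant_form0r shapovalov_linearr).
rewrite big_cons shapovalov_linearr IHr // addr0.
by rewrite shapovalov_bvec ?parts_ge1 // l0 mul0rn mulr0.
Qed.

Lemma regular_charge_neq0 : shapovalov_regular phi -> c0 <> 0.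
Proof.
move=> /(_ 1%N isT) + c0_eq0; rewrite det_gram_part_norm => /prodf_neq0.
(* The partition (1) contributes the factor omega_1 phi(c) to the determinant for n = 1. *)
have [l lE] := @intpart_of_seq 1 [:: 1%N] isT.
by move=> /(_ l isT); rewrite lE /= c0_eq0 !(mulr0, mul0r) eqxx.
Qed.

(** By [annihilate_bvec] every other term of the expansion dies. The length bound concerns only
    terms with nonzero coefficient, since [r] may also list others. *)
Lemma annihilate_sum (r : seq (seq nat)) (a : seq nat -> K) s :
  uniq r -> all sorted_parts r -> s \in r ->
  (forall t, t \in r -> a t != 0 -> (size t <= size s)%N) ->
  annihilate s (\sum_(t <- r) ((a t)%:A : U) *: bvec t)
    = ((a s * part_norm phi s)%:A : U) *: vac.
Proof.
move=> r_uniq /allP rP sr s_max.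
have s0 : all (leq 1) s by have /andP[] := rP s sr.
rewrite (big_morph _ (annihilateD s) (annihilate0 phi s)).
rewrite (bigD1_seq s) //= big_seq_cond big1 => [|t /andP[tr ts]].
  by rewrite addr0 annihilateZ annihilate_bvec // uscalM perm_refl.
rewrite annihilateZ; have [->|/(s_max t tr) size_t] := eqVneq (a t) 0.
  by rewrite uscal0.
rewrite annihilate_bvec // (@perm_sorted_eq r) // 1?eq_sym ?(negPf ts).
  by rewrite uscal0 scaler0.
by apply/allP => t' /rP /andP[].
Qed.

Lemma charge_neq0_irreducible : w != 0 -> c0 <> 0 -> irreducible_module M.
Proof.
move=> w0 /eqP c0_neq0; split.
  by exists vac; apply/eqP; exact: (@bvec_neq0 _ _ phi [::]).
move=> N Nsub.
have N_scale u v : v \in N -> u *: v \in N.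
  by move=> vN; rewrite -[_ *: _]addr0; apply: Nsub.2 => //; exact: Nsub.1.
have [[x [xN x0]]|/forallNP N0] := pselect (exists x, x \in N /\ x <> 0);
    last first.
  left=> x; apply/idP/eqP => [xN|->]; last exact: Nsub.1.
  by apply: contrapT => x0; exact: (N0 x).
right; have [r [a [r_uniq rP xE]]] := bvec_expansion x.
(* A longest sequence of the support; the support is nonempty because x is nonzero. *)
have [|s] := @exists_maximal _ size [seq t <- r | a t != 0].
  apply/eqP => r_nil; apply: x0; rewrite xE big_seq big1 // => t tr.
  have : t \notin [seq t <- r | a t != 0] by rewrite r_nil.
  by rewrite mem_filter tr andbT negbK => /eqP ->; exact: uscal0.
rewrite mem_filter => /andP[as0 sr] s_max.
have s0 : all (leq 1) s by have /andP[] := allP rP s sr.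
have asN : annihilate s x \in N.
  by elim: (s) x xN {x0 xE} => //= k s' IHs x xN; apply/IHs/N_scale.
have vacN : vac \in N.
  rewrite xE annihilate_sum // in asN; last first.
    by move=> t tr at0; apply: s_max; rewrite mem_filter at0.
  have := N_scale ((a s * part_norm phi s)^-1%:A) _ asN.
  by rewrite uscalM mulVf ?uscal1 // mulf_neq0 // part_norm_neq0.
(* Once v lies in N, so does every PBW vector, hence all of M(phi). *)
move=> y; rewrite inE; have [r' [_ ->]] := in_spanT y.
elim/big_rec: _ => [|p z _ zN]; first exact: Nsub.1.
apply: Nsub.2 => //.
by elim: (p.2) => //= k s' IHs; exact: N_scale.
Qed.

End Shapovalov.

Theorem theorem3p8 (R : realType) (omega1 : R) (omega1_gt0 : 0 < omega1)
    (phi : {scalar heis0 (omega1%:C)}) :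
  [<-> irreducible_module (verma phi);
       nondegenerate_form (shapovalov phi);
       shapovalov_regular phi;
       phi (c_heis0 (omega1%:C)) <> 0]
  /\
  (forall n : nat,
     is_diag_mx (gram phi n) /\
     \det (gram phi n) =
       \prod_(l : intpart n) \prod_(1 <= k < n.+1)
         ((k%:R * omega1%:C * phi (c_heis0 (omega1%:C))) ^+ part_mult l k
          * (part_mult l k)`!%:R)).
Proof.
have w0 : omega1%:C != 0.
  by apply/eqP => /(congr1 (@complex.Re R)) /= /eqP; rewrite gt_eqF.
split; last by move=> n; split; [exact: gram_is_diag | exact: det_gram].
tfae.
- exact: irreducible_nondegenerate.
- exact: nondegenerate_regular.
- exact: regular_charge_neq0.
- exact: charge_neq0_irreducible.
Qed.
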